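(* For all $\tau\in\mathbb{H}$, $$\frac{v^2u}{w^3}+\frac{u^2w}{v^3}-\frac{w^2v}{u^3}=\left(\frac{\eta(\tau)}{\eta(7\tau)}\right)^4+8,$$ $$\frac{w^3}{v^2u}+\frac{v^3}{u^2w}-\frac{u^3}{w^2v}=-\left(\frac{\eta(\tau)}{\eta(7\tau)}\right)^4-5.$$
   Context: Let $\tau\in\mathbb{H}$, $q=e^{2\pi i\tau}$, $q^{\alpha}=e^{2\pi i\alpha\tau}$. Define $u=q^{1/56}\prod_{k\ge0}(1-q^{7k+3})(1-q^{7k+4})(1-q^{7k+7})$, $v=q^{9/56}\prod_{k\ge0}(1-q^{7k+2})(1-q^{7k+5})(1-q^{7k+7})$, $w=q^{25/56}\prod_{k\ge0}(1-q^{7k+1})(1-q^{7k+6})(1-q^{7k+7})$, and $\eta(\tau)=q^{1/24}\prod_{n\ge1}(1-q^n)$. *)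

(* Defs.v *)
From Stdlib Require Import Reals.
From Coquelicot Require Import Coquelicot.
Open Scope R_scope.

Definition cexp (z : C) : C := (exp (Re z) * cos (Im z), exp (Re z) * sin (Im z)).

Definition qpow (tau : C) (alpha : R) : C :=
  cexp (Cmult (RtoC (2 * PI * alpha)) (Cmult Ci tau)).

Fixpoint cprod (f : nat -> C) (N : nat) : C :=
  match N with
  | O => RtoC 1
  | S n => Cmult (cprod f n) (f n)
  end.

Definition is_inf_prod (f : nat -> C) (l : C) : Prop :=
  filterlim (cprod f) eventually (locally l).

Definition omq (tau : C) (n : nat) : C := Cminus (RtoC 1) (qpow tau (INR n)).

Definition u_fac (tau : C) (k : nat) : C :=
  Cmult (Cmult (omq tau (7*k+3)) (omq tau (7*k+4))) (omq tau (7*k+7)).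
Definition v_fac (tau : C) (k : nat) : C :=
  Cmult (Cmult (omq tau (7*k+2)) (omq tau (7*k+5))) (omq tau (7*k+7)).
Definition w_fac (tau : C) (k : nat) : C :=
  Cmult (Cmult (omq tau (7*k+1)) (omq tau (7*k+6))) (omq tau (7*k+7)).

Definition eta_fac (tau : C) (k : nat) : C := omq tau (S k).

(* Main.v *)
Require Import Defs.
From Stdlib Require Import Reals Lra Lia ZArith List Permutation.
From Coquelicot Require Import Coquelicot.
Open Scope R_scope.

(* With p = q^7 and theta(x) = prod (1 - x p^k)(1 - p^(k+1)/x), the functions u, v, w are
   theta(q^3), theta(q^2), theta(q) up to the factor prod (1 - p^k) and powers of q: the point
   x = q is a 7-torsion point of the elliptic curve C^*/p^Z.  The Jacobi triple product, applied
   to theta(xy) theta(x/y), exhibits it as a 2x2 determinant in functions of x and of y; this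
   gives Weierstrass's three-term relation, that is
   wp(b) - wp(a) = sigma(a+b) sigma(a-b) / (sigma(a) sigma(b))^2.
   At the multiples of the torsion point the three-term relation is the Klein quartic
   v^3 u = u^3 w + w^3 v, so that all quantities are rational in Z = w^2 v / u^3.  Finally, the
   monic cubic f with roots wp(half periods) is determined by its values at wp(q), wp(q^2), wp(q^3),
   which are sigma(2a)^2 / (4 sigma(a)^8); its discriminant, p/16, comes from the same product
   formulas at the half periods and yields
   (eta(tau)/eta(7 tau))^4 = (1 - 5 Z - 8 Z^2 - Z^3) / (Z (1 + Z)).
   In the code points are written additively, x = exp z, with p = exp t and q = exp T. *)

(** * Limits and infinite products of complex numbers *)

(** The three-term relation at the torsion points is homogeneous in the three theta values: it fixes
    ratios such as Z, but not the product theta(q) theta(q^2) theta(q^3), which is what the eta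
    quotient measures once exponents are sorted by residue mod 7. The discriminant supplies the
    missing scale. Sums of half periods are again half periods, so it involves the theta values
    there only through their product, and Euler's identity prod (1 + p^k)(1 - p^(2k-1)) = 1 makes
    that product equal to 2. No function theory enters. Theta identities come either from exact
    identities between partial products, up to a boundary factor tending to 1, or from series. The
    series need two analytic tools: Tannery's theorem, to let the finite triple product tend to the
    infinite one, and rearrangement of absolutely convergent sums, to regroup a double series by the
    parity of the sum of its indices. That regrouping separates the variables and creates the
    determinant. Working with logarithms of points makes fractional powers of q and half periods
    unambiguous. *)

Lemma Cdiv_neq_0 (a b : C) : a <> 0%C -> b <> 0%C -> (a / b)%C <> 0%C.
Proof.
  intros Ha Hb E. apply Ha. transitivity (a / b * b)%C; [now field|]. rewrite E. ring.
Qed.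

Definition Clim (s : nat -> C) (l : C) : Prop :=
  is_lim_seq (fun n => Cmod (s n - l)) 0.

Lemma Clim_spec (s : nat -> C) (l : C) :
  Clim s l <->
  forall eps : R, 0 < eps -> exists N, forall n, (N <= n)%nat -> Cmod (s n - l) < eps.
Proof.
  unfold Clim; rewrite <- is_lim_seq_spec; split.
  - intros H eps Heps. destruct (H (mkposreal eps Heps)) as [N HN].
    exists N; intros n Hn; specialize (HN n Hn); simpl in HN.
    now rewrite Rminus_0_r, Rabs_pos_eq in HN by apply Cmod_ge_0.
  - intros H eps. destruct (H eps (cond_pos eps)) as [N HN].
    exists N; intros n Hn. rewrite Rminus_0_r, Rabs_pos_eq by apply Cmod_ge_0. auto.
Qed.

Lemma Clim_squeeze (s : nat -> C) (l : C) (b : nat -> R) :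
  (forall n, Cmod (s n - l) <= b n) -> is_lim_seq b 0 -> Clim s l.
Proof.
  intros H Hb.
  apply is_lim_seq_le_le with (fun _ => 0) b; [|apply is_lim_seq_const|exact Hb].
  intros n; split; [apply Cmod_ge_0 | apply H].
Qed.

Lemma Clim_ext (s s' : nat -> C) (l : C) :
  (forall n, s n = s' n) -> Clim s l -> Clim s' l.
Proof.
  intros H; apply is_lim_seq_ext; intros n; now rewrite H.
Qed.

Lemma Clim_const (c : C) : Clim (fun _ => c) c.
Proof.
  apply Clim_squeeze with (fun _ => 0); [|apply is_lim_seq_const].
  intros _; replace (c - c)%C with (RtoC 0) by ring; rewrite Cmod_0; lra.
Qed.

Lemma Clim_unique (s : nat -> C) (l l' : C) : Clim s l -> Clim s l' -> l = l'.
Proof.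
  intros H H'.
  assert (Hc : Cmod (l - l') <= 0).
  { apply (is_lim_seq_le (fun _ => Cmod (l - l'))
             (fun n => Cmod (s n - l) + Cmod (s n - l')) (Cmod (l - l')) 0).
    - intros n. rewrite <- (Cmod_opp (s n - l)).
      replace (l - l')%C with (- (s n - l) + (s n - l'))%C by ring. apply Cmod_triangle.
    - apply is_lim_seq_const.
    - replace (Finite 0) with (Rbar_plus 0 0) by (simpl; f_equal; lra).
      apply is_lim_seq_plus'; assumption. }
  assert (H0 : Cmod (l - l') = 0) by (pose proof (Cmod_ge_0 (l - l')); lra).
  apply Ceq_minus, Cmod_eq_0, H0.
Qed.

Lemma Clim_plus (s s' : nat -> C) (l l' : C) :
  Clim s l -> Clim s' l' -> Clim (fun n => s n + s' n)%C (l + l')%C.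
Proof.
  intros H H'.
  apply Clim_squeeze with (fun n => Cmod (s n - l) + Cmod (s' n - l')).
  - intros n. replace (s n + s' n - (l + l'))%C with ((s n - l) + (s' n - l'))%C by ring.
    apply Cmod_triangle.
  - replace (Finite 0) with (Finite (0 + 0)) by (f_equal; lra).
    apply is_lim_seq_plus'; assumption.
Qed.

Lemma Clim_mult (s s' : nat -> C) (l l' : C) :
  Clim s l -> Clim s' l' -> Clim (fun n => s n * s' n)%C (l * l')%C.
Proof.
  intros H H'.
  apply Clim_squeeze with (fun n => Cmod (s n - l) * Cmod (s' n - l') +
    (Cmod l * Cmod (s' n - l') + Cmod l' * Cmod (s n - l))).
  - intros n.
    replace (s n * s' n - l * l')%C
      with ((s n - l) * (s' n - l') + (l * (s' n - l') + l' * (s n - l)))%C by ring.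
    eapply Rle_trans; [apply Cmod_triangle|]. rewrite Cmod_mult.
    apply Rplus_le_compat_l.
    eapply Rle_trans; [apply Cmod_triangle|]. rewrite !Cmod_mult. apply Rle_refl.
  - replace (Finite 0) with (Finite (0 * 0 + (Cmod l * 0 + Cmod l' * 0))) by (f_equal; ring).
    apply is_lim_seq_plus'; [apply is_lim_seq_mult'; assumption|].
    apply is_lim_seq_plus'; apply is_lim_seq_mult'; try assumption; apply is_lim_seq_const.
Qed.

Lemma Clim_scal (c : C) (s : nat -> C) (l : C) :
  Clim s l -> Clim (fun n => c * s n)%C (c * l)%C.
Proof. apply Clim_mult, Clim_const. Qed.

Lemma Clim_minus (s s' : nat -> C) (l l' : C) :
  Clim s l -> Clim s' l' -> Clim (fun n => s n - s' n)%C (l - l')%C.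
Proof.
  intros H H'. apply Clim_ext with (fun n => s n + (-(1)) * s' n)%C; [intros n; ring|].
  replace (l - l')%C with (l + (-(1)) * l')%C by ring.
  apply Clim_plus; [|apply Clim_scal]; assumption.
Qed.

Lemma Clim_inv (s : nat -> C) (l : C) :
  l <> 0%C -> Clim s l -> Clim (fun n => / s n)%C (/ l)%C.
Proof.
  intros Hl H.
  assert (Hp : 0 < Cmod l) by now apply Cmod_gt_0.
  assert (He : eventually (fun n => Cmod (s n - l) < Cmod l / 2)).
  { apply (proj1 (Clim_spec s l) H). lra. }
  apply is_lim_seq_le_le_loc with (fun _ => 0) (fun n => (2 / (Cmod l * Cmod l)) * Cmod (s n - l)).
  - destruct He as [N HN]; exists N; intros n Hn; split; [apply Cmod_ge_0|].
    specialize (HN n Hn).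
    assert (Hs : Cmod l / 2 < Cmod (s n)).
    { assert (Cmod l <= Cmod (s n) + Cmod (s n - l)); [|lra].
      rewrite <- (Cmod_opp (s n - l)).
      replace l with (s n + - (s n - l))%C at 1 by ring. apply Cmod_triangle. }
    assert (Hn0 : s n <> 0%C) by (apply Cmod_gt_0; lra).
    replace (/ s n - / l)%C with (- (s n - l) * (/ (s n * l)))%C by (field; auto).
    rewrite Cmod_mult, Cmod_opp, Cmod_inv, Cmod_mult by now apply Cmult_neq_0.
    rewrite Rmult_comm. apply Rmult_le_compat_r; [apply Cmod_ge_0|].
    replace (2 / (Cmod l * Cmod l)) with (/ (Cmod l / 2 * Cmod l)) by (field; lra).
    apply Rinv_le_contravar; [nra|]. apply Rmult_le_compat_r; lra.
  - apply is_lim_seq_const.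
  - replace (Finite 0) with (Finite (2 / (Cmod l * Cmod l) * 0)) by (f_equal; ring).
    apply is_lim_seq_mult'; [apply is_lim_seq_const|exact H].
Qed.

Lemma Clim_subseq (s : nat -> C) (l : C) (phi : nat -> nat) :
  (forall n, (n <= phi n)%nat) -> Clim s l -> Clim (fun n => s (phi n)) l.
Proof.
  intros Hphi H. apply (is_lim_seq_subseq (fun n => Cmod (s n - l)) 0 phi); [|exact H].
  intros P [N HN]; exists N; intros n Hn. apply HN. specialize (Hphi n); lia.
Qed.

Lemma Clim_bounded (s : nat -> C) (l : C) :
  Clim s l -> exists M, 0 < M /\ forall n, Cmod (s n) <= M.
Proof.
  intros H.
  assert (Hb : bound (fun x => exists n, x = Cmod (s n - l))).
  { destruct (proj1 (Clim_spec s l) H 1 ltac:(lra)) as [N HN].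
    assert (HF : forall m, exists B, forall n, (n < m)%nat -> Cmod (s n - l) <= B).
    { induction m as [|m [B HB]]; [exists 0; lia|].
      exists (Rmax B (Cmod (s m - l))). intros n Hn.
      destruct (Nat.eq_dec n m) as [->|Hne]; [apply Rmax_r|].
      eapply Rle_trans; [apply HB; lia|apply Rmax_l]. }
    destruct (HF N) as [B HB]. exists (Rmax B 1). intros x [n ->].
    destruct (Nat.lt_ge_cases n N) as [Hn|Hn].
    - eapply Rle_trans; [apply HB, Hn|apply Rmax_l].
    - specialize (HN n Hn). pose proof (Rmax_r B 1). lra. }
  destruct Hb as [B HB].
  exists (B + Cmod l + 1). split.
  - assert (Cmod (s O - l) <= B) by (apply HB; eauto).
    pose proof (Cmod_ge_0 (s O - l)). pose proof (Cmod_ge_0 l). lra.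
  - intros n. assert (Cmod (s n - l) <= B) by (apply HB; eauto).
    replace (s n) with ((s n - l) + l)%C by ring.
    pose proof (Cmod_triangle (s n - l) l). lra.
Qed.

(** Completeness of the plane is reduced to that of the line: [Re] and [Im] are 1-Lipschitz for
    [Cmod], so both component sequences inherit the Cauchy property from [b]. *)
Lemma Clim_dominated (s : nat -> C) (b : nat -> R) :
  (forall n m, (n <= m)%nat -> Cmod (s m - s n) <= b m - b n) ->
  ex_finite_lim_seq b -> exists l, Clim s l.
Proof.
  intros H Hb.
  apply ex_lim_seq_cauchy_corr in Hb.
  assert (Hc : forall f : C -> R, (forall x y, Rabs (f x - f y) <= Cmod (x - y)) ->
     ex_finite_lim_seq (fun n => f (s n))).
  { intros f Hf. apply ex_lim_seq_cauchy_corr. intros eps.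
    destruct (Hb eps) as [N HN]. exists N.
    assert (Hw : forall n m, (N <= n)%nat -> (n <= m)%nat -> Rabs (f (s m) - f (s n)) < eps).
    { intros n m Hn Hm. eapply Rle_lt_trans; [apply Hf|].
      eapply Rle_lt_trans; [apply H, Hm|].
      eapply Rle_lt_trans; [apply Rle_abs|]. apply HN; lia. }
    intros n m Hn Hm. destruct (Nat.le_ge_cases n m).
    - rewrite Rabs_minus_sym. now apply Hw.
    - now apply Hw. }
  destruct (Hc Re) as [a Ha].
  { intros x y. replace (Re x - Re y) with (Re (x - y)%C) by (destruct x, y; simpl; ring).
    apply re_le_Cmod. }
  destruct (Hc Im) as [c Hc'].
  { intros x y. replace (Im x - Im y) with (Im (x - y)%C) by (destruct x, y; simpl; ring).
    eapply Rle_trans; [apply Rmax_r|apply (Rmax_Cmod (x - y)%C)]. }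
  exists (a, c).
  apply Clim_squeeze with (fun n => sqrt 2 * (Rabs (Re (s n) - a) + Rabs (Im (s n) - c))).
  - intros n. eapply Rle_trans; [apply Cmod_2Rmax|].
    apply Rmult_le_compat_l; [apply sqrt_pos|].
    destruct (s n) as [u v]; simpl. fold (u - a) (v - c).
    pose proof (Rabs_pos (u - a)); pose proof (Rabs_pos (v - c)).
    apply Rmax_lub; lra.
  - replace (Finite 0) with (Finite (sqrt 2 * (Rabs (a - a) + Rabs (c - c))))
      by (rewrite !Rminus_diag, Rabs_R0; f_equal; ring).
    apply is_lim_seq_mult'; [apply is_lim_seq_const|].
    apply is_lim_seq_plus'; apply (is_lim_seq_abs _ (Finite _));
      apply is_lim_seq_minus'; try assumption; apply is_lim_seq_const.
Qed.

Lemma is_inf_prod_Clim (f : nat -> C) (l : C) : is_inf_prod f l -> Clim (cprod f) l.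
Proof.
  intros H. apply Clim_spec. intros eps Heps.
  assert (Hs : 0 < sqrt 2) by (apply sqrt_lt_R0; lra).
  assert (He : 0 < eps / sqrt 2) by (apply Rdiv_lt_0_compat; assumption).
  destruct (proj1 (filterlim_locally (cprod f) l) H (mkposreal _ He)) as [N HN].
  exists N; intros n Hn. specialize (HN n Hn).
  pose proof (C_NormedModule_mixin_compat2 l (cprod f n) (mkposreal _ He) HN) as HH.
  simpl in HH. replace (sqrt 2 * (eps / sqrt 2)) with eps in HH by (field; lra).
  exact HH.
Qed.

Lemma cprod_mult (f g : nat -> C) (n : nat) :
  cprod (fun k => f k * g k)%C n = (cprod f n * cprod g n)%C.
Proof. induction n as [|n IH]; simpl; [ring|rewrite IH; ring]. Qed.

Lemma cprod_ext (f g : nat -> C) (n : nat) :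
  (forall k, f k = g k) -> cprod f n = cprod g n.
Proof. intros H; induction n as [|n IH]; simpl; [easy|now rewrite IH, H]. Qed.

Lemma cprod_S_l (f : nat -> C) (n : nat) :
  cprod f (S n) = (f O * cprod (fun k => f (S k)) n)%C.
Proof. induction n as [|n IH]; [simpl; ring|]. simpl in *. rewrite IH. ring. Qed.

Lemma cprod_nonzero (f : nat -> C) (n : nat) :
  (forall k, f k <> 0%C) -> cprod f n <> 0%C.
Proof.
  intros H; induction n as [|n IH]; simpl; [apply C1_nz|now apply Cmult_neq_0].
Qed.

(** By 1 + x <= exp x the partial products stay below [exp (Series a)], so each step of the product
    moves by at most a constant times [a n]. *)
Lemma cprod_cv (f : nat -> C) :
  ex_series (fun k => Cmod (f k - 1)) -> exists l, Clim (cprod f) l.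
Proof.
  intros Ha.
  set (a := fun k => Cmod (f k - 1)) in *.
  assert (Ha0 : forall k, 0 <= a k) by (intros k; apply Cmod_ge_0).
  (* [A n] adds the first [n] terms, in step with [cprod f n], whereas [sum_n a n] also includes
     index [n]. *)
  set (A := fun n => match n with O => 0 | S m => sum_n a m end).
  assert (HAS : forall n, A (S n) = A n + a n).
  { intros [|n]; simpl; [rewrite sum_O; ring|rewrite sum_Sn; reflexivity]. }
  assert (HAl : is_lim_seq A (Series a)).
  { apply is_lim_seq_incr_1. exact (Series_correct a Ha). }
  assert (HAi : forall n, A n <= Series a).
  { apply is_lim_seq_incr_compare; [exact HAl|].
    intros n. rewrite HAS. pose proof (Ha0 n). lra. }
  assert (Hb : forall n, Cmod (cprod f n) <= exp (A n)).
  { induction n as [|n IH]; [simpl; rewrite Cmod_1, exp_0; lra|].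
    simpl cprod. rewrite Cmod_mult, HAS, exp_plus.
    apply Rmult_le_compat; try apply Cmod_ge_0; [exact IH|].
    replace (f n) with (1 + (f n - 1))%C by ring.
    eapply Rle_trans; [apply Cmod_triangle|]. rewrite Cmod_1. apply exp_ineq1_le. }
  set (M := exp (Series a)).
  apply Clim_dominated with (fun n => M * A n).
  - intros n m Hnm. induction Hnm as [|m Hnm IH].
    + replace (cprod f n - cprod f n)%C with (RtoC 0) by ring. rewrite Cmod_0; lra.
    + simpl cprod. rewrite HAS.
      replace (cprod f m * f m - cprod f n)%C
        with (cprod f m * (f m - 1) + (cprod f m - cprod f n))%C by ring.
      eapply Rle_trans; [apply Cmod_triangle|]. rewrite Cmod_mult. fold (a m).
      assert (Cmod (cprod f m) * a m <= M * a m); [|lra].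
      apply Rmult_le_compat_r; [apply Ha0|].
      eapply Rle_trans; [apply Hb|]. unfold M.
      destruct (HAi m) as [Hlt| ->]; [left; now apply exp_increasing|right; reflexivity].
  - exists (M * Series a). apply is_lim_seq_mult'; [apply is_lim_seq_const|exact HAl].
Qed.

(** The product of the reciprocals converges too, since |1/z - 1| <= 2 |z - 1| once |z - 1| < 1/2,
    and the two limits multiply to 1. *)
Lemma cprod_lim_nonzero (f : nat -> C) (l : C) :
  ex_series (fun k => Cmod (f k - 1)) -> (forall k, f k <> 0%C) ->
  Clim (cprod f) l -> l <> 0%C.
Proof.
  intros Ha Hf Hl.
  destruct (cprod_cv (fun k => / f k)%C) as [l' Hl'].
  { pose proof (ex_series_lim_0 _ Ha) as H0.
    destruct (proj2 (is_lim_seq_spec _ 0) H0 (mkposreal (/ 2) ltac:(lra))) as [N HN].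
    apply (ex_series_incr_n _ N).
    apply (ex_series_le (K:=R_AbsRing) (V:=R_CompleteNormedModule) _ (fun k => 2 * Cmod (f (N + k)%nat - 1))).
    - intros k. specialize (HN (N + k)%nat ltac:(lia)); simpl in HN.
      rewrite Rminus_0_r, Rabs_pos_eq in HN by apply Cmod_ge_0.
      change (Rabs (Cmod (/ f (N + k)%nat - 1)) <= 2 * Cmod (f (N + k)%nat - 1)).
      rewrite Rabs_pos_eq by apply Cmod_ge_0.
      set (z := f (N + k)%nat) in *.
      assert (Hz : z <> 0%C) by apply Hf.
      replace (/ z - 1)%C with (- (z - 1) * / z)%C by (now field).
      rewrite Cmod_mult, Cmod_opp, Cmod_inv by exact Hz. rewrite Rmult_comm.
      apply Rmult_le_compat_r; [apply Cmod_ge_0|].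
      assert (/ 2 <= Cmod z).
      { pose proof (Cmod_triangle z (- (z - 1))) as HT. rewrite Cmod_opp in HT.
        replace (z + - (z - 1))%C with (RtoC 1) in HT by ring. rewrite Cmod_1 in HT. lra. }
      replace 2 with (/ / 2) by lra. apply Rinv_le_contravar; lra.
    - apply (ex_series_scal_l 2 (fun k => Cmod (f (N + k)%nat - 1))).
      apply (ex_series_incr_n (fun k => Cmod (f k - 1)) N), Ha. }
  assert (H1 : (l * l')%C = 1%C).
  { apply (Clim_unique (fun n => cprod f n * cprod (fun k => / f k) n)%C).
    - now apply Clim_mult.
    - apply Clim_ext with (fun _ => RtoC 1); [|apply Clim_const].
      intros n. rewrite <- cprod_mult.
      induction n as [|n IH]; simpl; [reflexivity|]. rewrite <- IH. field. apply Hf. }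
  intros ->. apply C1_nz. rewrite <- H1. ring.
Qed.

(** * Absolutely convergent sums over the integers *)

Definition csum {A : Type} (f : A -> C) (l : list A) : C :=
  fold_right (fun a s => f a + s)%C 0%C l.

Definition rsum {A : Type} (g : A -> R) (l : list A) : R :=
  fold_right (fun a s => g a + s) 0 l.

Lemma csum_cons {A : Type} (f : A -> C) (a : A) (l : list A) :
  csum f (a :: l) = (f a + csum f l)%C.
Proof. reflexivity. Qed.

Lemma csum_app {A : Type} (f : A -> C) (l1 l2 : list A) :
  csum f (l1 ++ l2) = (csum f l1 + csum f l2)%C.
Proof. induction l1 as [|a l1 IH]; simpl; [ring|rewrite IH; ring]. Qed.

Lemma csum_map {A B : Type} (f : B -> C) (h : A -> B) (l : list A) :
  csum f (map h l) = csum (fun a => f (h a)) l.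
Proof. induction l as [|a l IH]; simpl; [easy|now rewrite IH]. Qed.

Lemma csum_ext {A : Type} (f f' : A -> C) (l : list A) :
  (forall a, In a l -> f a = f' a) -> csum f l = csum f' l.
Proof.
  induction l as [|a l IH]; simpl; intros H; [easy|].
  rewrite H, IH; auto.
Qed.

Lemma csum_plus {A : Type} (f f' : A -> C) (l : list A) :
  csum (fun a => f a + f' a)%C l = (csum f l + csum f' l)%C.
Proof. induction l as [|a l IH]; simpl; [ring|rewrite IH; ring]. Qed.

Lemma csum_scal {A : Type} (c : C) (f : A -> C) (l : list A) :
  csum (fun a => c * f a)%C l = (c * csum f l)%C.
Proof. induction l as [|a l IH]; simpl; [ring|rewrite IH; ring]. Qed.

Lemma csum_prod {A B : Type} (f : A -> C) (g : B -> C) (l1 : list A) (l2 : list B) :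
  csum (fun ab => f (fst ab) * g (snd ab))%C (list_prod l1 l2) = (csum f l1 * csum g l2)%C.
Proof.
  induction l1 as [|a l1 IH]; simpl; [ring|].
  rewrite csum_app, IH, csum_map. simpl. rewrite csum_scal. ring.
Qed.

Lemma rsum_app {A : Type} (g : A -> R) (l1 l2 : list A) :
  rsum g (l1 ++ l2) = rsum g l1 + rsum g l2.
Proof. induction l1 as [|a l1 IH]; simpl; [ring|rewrite IH; ring]. Qed.

Lemma rsum_scal {A : Type} (c : R) (g : A -> R) (l : list A) :
  rsum (fun a => c * g a) l = c * rsum g l.
Proof. induction l as [|a l IH]; simpl; [ring|rewrite IH; ring]. Qed.

Lemma rsum_prod {A B : Type} (f : A -> R) (g : B -> R) (l1 : list A) (l2 : list B) :
  rsum (fun ab => f (fst ab) * g (snd ab)) (list_prod l1 l2) = rsum f l1 * rsum g l2.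
Proof.
  induction l1 as [|a l1 IH]; simpl; [ring|].
  rewrite rsum_app, IH.
  replace (rsum _ (map _ l2)) with (f a * rsum g l2); [ring|].
  clear IH; induction l2 as [|b l2 IH]; simpl; [ring|]. rewrite <- IH. ring.
Qed.

Lemma csum_perm {A : Type} (f : A -> C) (l l' : list A) :
  Permutation l l' -> csum f l = csum f l'.
Proof.
  induction 1 as [|x l l' _ IH|x y l|l l' l'' _ IH1 _ IH2]; simpl;
    [easy|now rewrite IH|ring|congruence].
Qed.

Lemma rsum_perm {A : Type} (g : A -> R) (l l' : list A) :
  Permutation l l' -> rsum g l = rsum g l'.
Proof.
  induction 1 as [|x l l' _ IH|x y l|l l' l'' _ IH1 _ IH2]; simpl;
    [easy|now rewrite IH|ring|congruence].
Qed.

Lemma Cmod_csum_le {A : Type} (f : A -> C) (g : A -> R) (l : list A) :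
  (forall a, Cmod (f a) <= g a) -> Cmod (csum f l) <= rsum g l.
Proof.
  intros H; induction l as [|a l IH]; simpl; [rewrite Cmod_0; lra|].
  eapply Rle_trans; [apply Cmod_triangle|]. specialize (H a). lra.
Qed.

Lemma incl_complement {A : Type} (l1 l2 : list A) :
  NoDup l1 -> incl l1 l2 -> exists l3, Permutation l2 (l1 ++ l3).
Proof.
  revert l2; induction l1 as [|a l1 IH]; intros l2 Hnd Hi; [exists l2; reflexivity|].
  inversion_clear Hnd as [|? ? Ha Hnd'].
  destruct (in_split a l2) as [x [y ->]]; [apply Hi; now left|].
  destruct (IH (x ++ y) Hnd') as [l3 H3].
  - intros b Hb. assert (Hb' : In b (x ++ a :: y)) by (apply Hi; now right).
    apply in_app_or in Hb'. apply in_or_app. destruct Hb' as [Hx|[->|Hy]]; auto. contradiction.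
  - exists l3. rewrite <- Permutation_middle. simpl. now constructor.
Qed.

Lemma csum_incl_bound {A : Type} (f : A -> C) (g : A -> R) (l1 l2 : list A) :
  (forall a, Cmod (f a) <= g a) -> NoDup l1 -> incl l1 l2 ->
  Cmod (csum f l2 - csum f l1) <= rsum g l2 - rsum g l1.
Proof.
  intros Hg Hnd Hi. destruct (incl_complement l1 l2 Hnd Hi) as [l3 H3].
  rewrite (csum_perm _ _ _ H3), (rsum_perm _ _ _ H3), csum_app, rsum_app.
  replace (csum f l1 + csum f l3 - csum f l1)%C with (csum f l3) by ring.
  pose proof (Cmod_csum_le f g l3 Hg). lra.
Qed.

Lemma rsum_incl_le {A : Type} (g : A -> R) (l1 l2 : list A) :
  (forall a, 0 <= g a) -> NoDup l1 -> incl l1 l2 -> rsum g l1 <= rsum g l2.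
Proof.
  intros Hg Hnd Hi.
  pose proof (csum_incl_bound (fun _ => 0%C) g l1 l2) as H.
  assert (0 <= rsum g l2 - rsum g l1); [|lra].
  eapply Rle_trans; [|apply H; auto]; [apply Cmod_ge_0|].
  intros a. rewrite Cmod_0. apply Hg.
Qed.

(** Absolute convergence along growing duplicate-free finite lists, so that one theory serves both
    the integers and pairs of integers. *)
Definition summable {A : Type} (E : nat -> list A) (g : A -> R) : Prop :=
  (forall n, NoDup (E n)) /\ (forall n m, (n <= m)%nat -> incl (E n) (E m)) /\
  (forall a, 0 <= g a) /\ exists G, is_lim_seq (fun n => rsum g (E n)) (Finite G).

Lemma summable_le {A : Type} (E : nat -> list A) (g : A -> R) (G : R) :
  summable E g -> is_lim_seq (fun n => rsum g (E n)) (Finite G) ->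
  forall n, rsum g (E n) <= G.
Proof.
  intros (Hnd & Hi & Hg & _) HG. apply is_lim_seq_incr_compare; [exact HG|].
  intros n; apply rsum_incl_le; auto.
Qed.

Lemma summable_scal {A : Type} (E : nat -> list A) (g : A -> R) (c : R) :
  0 <= c -> summable E g -> summable E (fun a => c * g a).
Proof.
  intros Hc (Hnd & Hi & Hg & G & HG). repeat split; auto.
  - intros a; specialize (Hg a); nra.
  - exists (c * G). apply is_lim_seq_ext with (fun n => c * rsum g (E n)).
    + intros n; symmetry; apply rsum_scal.
    + apply is_lim_seq_mult'; [apply is_lim_seq_const|exact HG].
Qed.

Lemma summable_cv {A : Type} (E : nat -> list A) (g : A -> R) (f : A -> C) :
  summable E g -> (forall a, Cmod (f a) <= g a) -> exists l, Clim (fun n => csum f (E n)) l.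
Proof.
  intros (Hnd & Hi & Hg & G & HG) Hf.
  apply Clim_dominated with (fun n => rsum g (E n)); [|now exists G].
  intros n m Hnm. apply csum_incl_bound; auto.
Qed.

(** Each [L n] lies between [E (phi n)] and some [E m], so replacing [E (phi n)] by [L n] costs at
    most the tail of [g] beyond [E (phi n)]. *)
Lemma Clim_rearrange {A : Type} (E L : nat -> list A) (g : A -> R) (f : A -> C) (l : C)
    (phi : nat -> nat) :
  summable E g -> (forall a, Cmod (f a) <= g a) ->
  (forall n, NoDup (L n)) -> (forall n, incl (E (phi n)) (L n)) ->
  (forall n, exists m, incl (L n) (E m)) ->
  filterlim phi eventually eventually ->
  Clim (fun n => csum f (E n)) l -> Clim (fun n => csum f (L n)) l.
Proof.
  intros HE Hf HL Hin Hout Hphi Hl.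
  destruct HE as (Hnd & Hi & Hg & G & HG).
  apply Clim_squeeze with (fun n => (G - rsum g (E (phi n))) + Cmod (csum f (E (phi n)) - l)).
  - intros n.
    replace (csum f (L n) - l)%C
      with ((csum f (L n) - csum f (E (phi n))) + (csum f (E (phi n)) - l))%C by ring.
    eapply Rle_trans; [apply Cmod_triangle|]. apply Rplus_le_compat_r.
    eapply Rle_trans; [apply csum_incl_bound with (g := g); auto|].
    destruct (Hout n) as [m Hm].
    assert (rsum g (L n) <= rsum g (E m)) by (apply rsum_incl_le; auto).
    assert (rsum g (E m) <= G) by (apply (summable_le E); [repeat split; eauto|exact HG]).
    lra.
  - replace (Finite 0) with (Finite ((G - G) + 0)) by (f_equal; ring).
    apply is_lim_seq_plus'.
    + apply is_lim_seq_minus'; [apply is_lim_seq_const|].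
      exact (is_lim_seq_subseq _ _ phi Hphi HG).
    + exact (is_lim_seq_subseq (fun n => Cmod (csum f (E n) - l)) _ phi Hphi Hl).
Qed.

Lemma Clim_csum_zero {A : Type} (f : nat -> A -> C) (l : list A) :
  (forall a, Clim (fun n => f n a) 0%C) -> Clim (fun n => csum (f n) l) 0%C.
Proof.
  intros H; induction l as [|a l IH]; simpl; [apply Clim_const|].
  pose proof (Clim_plus _ _ _ _ (H a) IH) as Hp. now rewrite Cplus_0_l in Hp.
Qed.

(** Dominated convergence for sums whose range grows with [n]: beyond a fixed [E K] the sum is at
    most [B] times a tail of [g], and the finitely many remaining terms vanish one by one. *)
Lemma tannery {A : Type} (E : nat -> list A) (g : A -> R) (t : A -> C)
    (h : nat -> A -> C) (B : R) :
  summable E g -> (forall a, Cmod (t a) <= g a) -> 0 < B ->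
  (forall n a, Cmod (h n a) <= B) -> (forall a, Clim (fun n => h n a) 0%C) ->
  Clim (fun n => csum (fun a => h n a * t a)%C (E n)) 0%C.
Proof.
  intros HE Ht HB Hh Hlim.
  pose proof HE as (Hnd & Hi & Hg & G & HG).
  apply Clim_spec. intros eps Heps.
  destruct (proj2 (is_lim_seq_spec _ G) HG (mkposreal (eps / 2 / B) ltac:(
    apply Rdiv_lt_0_compat; lra))) as [K HK].
  specialize (HK K (Nat.le_refl K)); simpl in HK.
  assert (HGK : G - rsum g (E K) < eps / 2 / B).
  { rewrite Rabs_minus_sym in HK. pose proof (Rle_abs (G - rsum g (E K))). lra. }
  assert (Hfin : Clim (fun n => csum (fun a => h n a * t a)%C (E K)) 0%C).
  { apply Clim_csum_zero. intros a.
    pose proof (Clim_mult _ _ _ _ (Hlim a) (Clim_const (t a))) as Hp.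
    now rewrite Cmult_0_l in Hp. }
  destruct (proj1 (Clim_spec _ _) Hfin (eps / 2) ltac:(lra)) as [N HN].
  exists (max N K). intros n Hn.
  specialize (HN n ltac:(lia)).
  set (s := fun L => csum (fun a => h n a * t a)%C L) in *.
  change (Cmod (s (E K) - 0) < eps / 2) in HN.
  change (Cmod (s (E n) - 0) < eps).
  replace (s (E n) - 0)%C with ((s (E n) - s (E K)) + (s (E K) - 0))%C by ring.
  eapply Rle_lt_trans; [apply Cmod_triangle|].
  assert (Cmod (s (E n) - s (E K)) <= B * (G - rsum g (E K))).
  { unfold s. eapply Rle_trans.
    - apply csum_incl_bound with (g := fun a => B * g a); [|auto|apply Hi; lia].
      intros a. rewrite Cmod_mult. apply Rmult_le_compat; try apply Cmod_ge_0; auto.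
    - rewrite !rsum_scal. pose proof (summable_le E g G HE HG n). nra. }
  assert (B * (G - rsum g (E K)) < eps / 2).
  { apply Rlt_le_trans with (B * (eps / 2 / B)); [apply Rmult_lt_compat_l; lra|].
    right; field; lra. }
  lra.
Qed.

Definition zrange (n : nat) : list Z :=
  map (fun k => Z.of_nat k - Z.of_nat n)%Z (seq 0 (2 * n + 1)).

Lemma in_zrange (n : nat) (k : Z) :
  In k (zrange n) <-> (- Z.of_nat n <= k <= Z.of_nat n)%Z.
Proof.
  unfold zrange. rewrite in_map_iff. split.
  - intros [j [<- Hj]]. apply in_seq in Hj. lia.
  - intros H. exists (Z.to_nat (k + Z.of_nat n)). rewrite in_seq. lia.
Qed.

Lemma NoDup_zrange (n : nat) : NoDup (zrange n).
Proof.
  apply NoDup_map_NoDup_ForallPairs; [|apply seq_NoDup].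
  intros a b _ _ H. lia.
Qed.

(** A geometric majorant with an explicit sum; Gaussian terms decay faster, so it dominates every
    theta series below up to a constant. *)
Definition zweight (k : Z) : R := (/ 2) ^ Z.abs_nat k.

Lemma zweight_pos (k : Z) : 0 <= zweight k.
Proof. apply pow_le; lra. Qed.

Lemma rsum_zweight (n : nat) : rsum zweight (zrange n) = 3 - 2 * (/ 2) ^ n.
Proof.
  induction n as [|n IH].
  - unfold zrange, zweight; simpl; lra.
  - assert (HP : Permutation (zrange (S n))
                   (Z.of_nat (S n) :: (- Z.of_nat (S n))%Z :: zrange n)).
    { apply NoDup_Permutation.
      - apply NoDup_zrange.
      - constructor; [|constructor; [|apply NoDup_zrange]]; cbn [In]; rewrite ?in_zrange; lia.
      - intros k. cbn [In]. rewrite !in_zrange. lia. }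
    rewrite (rsum_perm _ _ _ HP). cbn [rsum fold_right]. fold (rsum zweight (zrange n)).
    rewrite IH. unfold zweight.
    replace (Z.abs_nat (- Z.of_nat (S n))) with (S n) by lia.
    rewrite Zabs2Nat.id. simpl. lra.
Qed.

Lemma summable_zweight : summable zrange zweight.
Proof.
  repeat split.
  - apply NoDup_zrange.
  - intros n m Hnm k. rewrite !in_zrange. lia.
  - apply zweight_pos.
  - exists 3. apply is_lim_seq_ext with (fun n => 3 - 2 * (/ 2) ^ n).
    + intros n; symmetry; apply rsum_zweight.
    + replace 3 with (3 - 2 * 0) at 1 by ring.
      apply is_lim_seq_minus'; [apply is_lim_seq_const|].
      apply is_lim_seq_mult'; [apply is_lim_seq_const|].
      apply is_lim_seq_geom. rewrite Rabs_pos_eq; lra.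
Qed.

Definition zsquare (n : nat) : list (Z * Z) := list_prod (zrange n) (zrange n).

Lemma in_zsquare (n : nat) (j k : Z) :
  In (j, k) (zsquare n) <->
  (- Z.of_nat n <= j <= Z.of_nat n)%Z /\ (- Z.of_nat n <= k <= Z.of_nat n)%Z.
Proof. unfold zsquare. now rewrite in_prod_iff, !in_zrange. Qed.

Lemma NoDup_zsquare (n : nat) : NoDup (zsquare n).
Proof.
  unfold zsquare. pose proof (NoDup_zrange n) as H1. pose proof H1 as H2.
  revert H1 H2. generalize (zrange n) at 1 3 as l1. generalize (zrange n) as l2.
  intros l2 l1 H1 H2. induction H1 as [|a l1 Ha H1 IH]; simpl; [constructor|].
  apply NoDup_app; [| exact IH |].
  - apply NoDup_map_NoDup_ForallPairs; [|exact H2]. intros x y _ _ H. congruence.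
  - intros [x y] Hx Hy. apply in_map_iff in Hx. destruct Hx as [z [Hz _]].
    injection Hz as -> ->. apply in_prod_iff in Hy. tauto.
Qed.

Lemma summable_zsquare :
  summable zsquare (fun jk => zweight (fst jk) * zweight (snd jk)).
Proof.
  destruct summable_zweight as (_ & _ & _ & G & HG).
  repeat split.
  - apply NoDup_zsquare.
  - intros n m Hnm [j k]. rewrite !in_zsquare. lia.
  - intros [j k]; simpl. apply Rmult_le_pos; apply zweight_pos.
  - exists (G * G). apply is_lim_seq_ext with (fun n => rsum zweight (zrange n) * rsum zweight (zrange n)).
    + intros n; symmetry; apply rsum_prod.
    + now apply is_lim_seq_mult'.
Qed.

(** * Theta products and the Jacobi triple product *)

Lemma Clim_ext_loc (s s' : nat -> C) (l : C) :
  (exists N, forall n, (N <= n)%nat -> s n = s' n) -> Clim s l -> Clim s' l.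
Proof.
  intros [N HN]. apply is_lim_seq_ext_loc. exists N; intros n Hn. now rewrite HN.
Qed.

(** [Lim_seq] is total, so this turns limits into functions; the value is meaningful only where
    convergence is proved. *)
Definition Cval (s : nat -> C) : C :=
  (real (Lim_seq (fun n => Re (s n))), real (Lim_seq (fun n => Im (s n)))).

Lemma Clim_Cval (s : nat -> C) (l : C) : Clim s l -> Cval s = l.
Proof.
  intros H.
  assert (Hf : forall f : C -> R, (forall x y, Rabs (f x - f y) <= Cmod (x - y)) ->
     Lim_seq (fun n => f (s n)) = f l).
  { intros f Hf. apply is_lim_seq_unique, is_lim_seq_spec. intros eps.
    destruct (proj1 (Clim_spec s l) H eps (cond_pos eps)) as [N HN].
    exists N; intros n Hn. eapply Rle_lt_trans; [apply Hf|auto]. }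
  unfold Cval. rewrite (Hf Re), (Hf Im).
  - destruct l; reflexivity.
  - intros x y. replace (Im x - Im y) with (Im (x - y)%C) by (destruct x, y; simpl; ring).
    eapply Rle_trans; [apply Rmax_r|apply (Rmax_Cmod (x - y)%C)].
  - intros x y. replace (Re x - Re y) with (Re (x - y)%C) by (destruct x, y; simpl; ring).
    apply re_le_Cmod.
Qed.

(** * The exponential and the factors of the theta and Euler products *)

Lemma cexp_plus (x y : C) : cexp (x + y) = (cexp x * cexp y)%C.
Proof.
  destruct x as [a b], y as [c d]. unfold cexp, Cmult; simpl.
  rewrite exp_plus, cos_plus, sin_plus. f_equal; ring.
Qed.

Lemma cexp_0 : cexp 0 = 1%C.
Proof. unfold cexp; simpl. rewrite exp_0, cos_0, sin_0. apply f_equal2; ring. Qed.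

Lemma Cmod_cexp (z : C) : Cmod (cexp z) = exp (Re z).
Proof.
  unfold cexp, Cmod; simpl.
  replace (_ + _) with (exp (Re z) * exp (Re z) * (Rsqr (sin (Im z)) + Rsqr (cos (Im z))))
    by (unfold Rsqr; ring).
  rewrite sin2_cos2, Rmult_1_r. apply sqrt_square. left; apply exp_pos.
Qed.

Lemma cexp_nonzero (z : C) : cexp z <> 0%C.
Proof. apply Cmod_gt_0. rewrite Cmod_cexp. apply exp_pos. Qed.

Lemma cexp_opp (z : C) : cexp (- z) = (/ cexp z)%C.
Proof.
  assert (H : (cexp (- z) * cexp z)%C = 1%C).
  { rewrite <- cexp_plus. replace (- z + z)%C with (RtoC 0) by ring. apply cexp_0. }
  rewrite <- (Cmult_1_l (/ cexp z)), <- H. field. apply cexp_nonzero.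
Qed.

Lemma cexp_minus (x y : C) : cexp (x - y) = (cexp x / cexp y)%C.
Proof. unfold Cminus. rewrite cexp_plus, cexp_opp. reflexivity. Qed.

Definition ipi : C := (0, PI).

Lemma cexp_ipi : cexp ipi = (-1)%C.
Proof. unfold cexp; simpl. rewrite exp_0, cos_PI, sin_PI. apply f_equal2; ring. Qed.

Lemma cexp_2ipi (m : Z) : cexp (IZR (2 * m) * ipi) = 1%C.
Proof.
  assert (Hnat : forall n : nat, cexp (IZR (2 * Z.of_nat n) * ipi) = 1%C).
  { induction n as [|n IH]; [simpl; rewrite Cmult_0_l; apply cexp_0|].
    replace (RtoC (IZR (2 * Z.of_nat (S n))) * ipi)%C
      with (RtoC (IZR (2 * Z.of_nat n)) * ipi + (ipi + ipi))%C.
    - rewrite !cexp_plus, IH, cexp_ipi. ring.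
    - replace (2 * Z.of_nat (S n))%Z with (2 * Z.of_nat n + 2)%Z by lia.
      rewrite plus_IZR, RtoC_plus. ring. }
  destruct (Z.le_ge_cases 0 m) as [H|H].
  - rewrite <- (Z2Nat.id m H). apply Hnat.
  - replace (RtoC (IZR (2 * m)) * ipi)%C with (- (IZR (2 * Z.of_nat (Z.to_nat (- m))) * ipi))%C.
    + rewrite cexp_opp, Hnat. field.
    + rewrite Z2Nat.id by lia. replace (2 * - m)%Z with (- (2 * m))%Z by ring.
      rewrite opp_IZR, RtoC_opp. ring.
Qed.

Definition etaf (t : C) (k : nat) : C := (1 - cexp (INR (S k) * t))%C.

Definition thetaf (t z : C) (k : nat) : C :=
  ((1 - cexp (z + INR k * t)) * (1 - cexp (INR (S k) * t - z)))%C.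

Lemma Cmod_cexp_INR (t z : C) (k : nat) :
  Cmod (cexp (z + INR k * t)) = exp (Re z) * exp (Re t) ^ k.
Proof.
  rewrite cexp_plus, Cmod_mult, !Cmod_cexp, re_scal_l. f_equal.
  induction k as [|k IH]; [simpl; rewrite Rmult_0_l; apply exp_0|].
  rewrite S_INR, Rmult_plus_distr_r, exp_plus, IH, Rmult_1_l. simpl; ring.
Qed.

Lemma ex_series_exp_geom (t : C) (M : R) :
  Re t < 0 -> ex_series (fun k => M * exp (Re t) ^ k).
Proof.
  intros Ht. apply (ex_series_scal_l M (fun k => exp (Re t) ^ k)).
  exists (/ (1 - exp (Re t))). apply is_series_geom.
  rewrite Rabs_pos_eq by (left; apply exp_pos). rewrite <- exp_0. now apply exp_increasing.
Qed.

Lemma etaf_series (t : C) : Re t < 0 -> ex_series (fun k => Cmod (etaf t k - 1)).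
Proof.
  intros Ht. eapply ex_series_ext; [|exact (ex_series_exp_geom t (exp (Re t)) Ht)].
  intros k. unfold etaf.
  replace (1 - cexp (INR (S k) * t) - 1)%C with (- cexp (t + INR k * t))%C.
  - now rewrite Cmod_opp, Cmod_cexp_INR.
  - rewrite S_INR, RtoC_plus. replace ((INR k + 1) * t)%C with (t + INR k * t)%C by ring. ring.
Qed.

Lemma thetaf_series (t z : C) : Re t < 0 -> ex_series (fun k => Cmod (thetaf t z k - 1)).
Proof.
  intros Ht.
  set (X := exp (Re z)). set (Y := exp (Re (t - z)%C)).
  apply (ex_series_le (K:=R_AbsRing) (V:=R_CompleteNormedModule) _
           (fun k => (X + Y + X * Y) * exp (Re t) ^ k)); [|now apply ex_series_exp_geom].
  intros k. change (Rabs (Cmod (thetaf t z k - 1)) <= (X + Y + X * Y) * exp (Re t) ^ k).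
  rewrite Rabs_pos_eq by apply Cmod_ge_0. unfold thetaf.
  replace (INR (S k) * t - z)%C with ((t - z) + INR k * t)%C
    by (rewrite S_INR, RtoC_plus; ring).
  set (x := cexp (z + _)). set (y := cexp (_ + _)).
  assert (Hx : Cmod x = X * exp (Re t) ^ k) by apply Cmod_cexp_INR.
  assert (Hy : Cmod y = Y * exp (Re t) ^ k) by apply Cmod_cexp_INR.
  replace ((1 - x) * (1 - y) - 1)%C with (- x + - y + x * y)%C by ring.
  eapply Rle_trans; [apply Cmod_triangle|].
  eapply Rle_trans; [apply Rplus_le_compat_r, Cmod_triangle|].
  rewrite !Cmod_opp, Cmod_mult, Hx, Hy.
  set (r := exp (Re t) ^ k).
  assert (Hr : 0 <= r <= 1).
  { split; [apply pow_le; left; apply exp_pos|].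
    rewrite <- (pow1 k). apply pow_incr. split; [left; apply exp_pos|].
    rewrite <- exp_0. left; now apply exp_increasing. }
  assert (0 < X * Y) by (apply Rmult_lt_0_compat; apply exp_pos).
  assert (X * Y * (r * r) <= X * Y * r) by (apply Rmult_le_compat_l; nra).
  lra.
Qed.

Lemma cexp_neq_1 (z : C) : Re z < 0 -> (1 - cexp z)%C <> 0%C.
Proof.
  intros Hz H. assert (Hc : cexp z = 1%C) by (symmetry; now apply Ceq_minus).
  apply (f_equal Cmod) in Hc. rewrite Cmod_cexp, Cmod_1, <- exp_0 in Hc.
  apply exp_inv in Hc. lra.
Qed.

Lemma etaf_nonzero (t : C) (k : nat) : Re t < 0 -> etaf t k <> 0%C.
Proof.
  intros Ht. apply cexp_neq_1. rewrite re_scal_l.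
  pose proof (lt_0_INR (S k) ltac:(lia)). nra.
Qed.

Definition theta (t z : C) : C := Cval (cprod (thetaf t z)).

Definition euler (t : C) : C := Cval (cprod (etaf t)).

Lemma theta_lim (t z : C) : Re t < 0 -> Clim (cprod (thetaf t z)) (theta t z).
Proof.
  intros Ht. destruct (cprod_cv _ (thetaf_series t z Ht)) as [l Hl].
  unfold theta. now rewrite (Clim_Cval _ _ Hl).
Qed.

Lemma euler_lim (t : C) : Re t < 0 -> Clim (cprod (etaf t)) (euler t).
Proof.
  intros Ht. destruct (cprod_cv _ (etaf_series t Ht)) as [l Hl].
  unfold euler. now rewrite (Clim_Cval _ _ Hl).
Qed.

Lemma euler_nonzero (t : C) : Re t < 0 -> euler t <> 0%C.
Proof.
  intros Ht. apply (cprod_lim_nonzero (etaf t)).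
  - now apply etaf_series.
  - intros k; now apply etaf_nonzero.
  - now apply euler_lim.
Qed.

Lemma theta_nonzero (t z : C) :
  Re t < 0 -> Re t < Re z < 0 -> theta t z <> 0%C.
Proof.
  intros Ht Hz. apply (cprod_lim_nonzero (thetaf t z)).
  - now apply thetaf_series.
  - intros k. pose proof (pos_INR k).
    apply Cmult_neq_0; apply cexp_neq_1.
    + replace (Re (z + INR k * t)%C) with (Re z + INR k * Re t); [nra|].
      destruct z, t; simpl; ring.
    + rewrite S_INR. replace (Re ((INR k + 1)%R * t - z)%C) with ((INR k + 1) * Re t - Re z); [nra|].
      destruct z, t; simpl; ring.
  - now apply theta_lim.
Qed.

(** Gaussian binomial coefficients in base [cexp t], by the q-Pascal rule. Where [n' - k'] is
    truncated, the coefficient it multiplies is zero. *)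
Fixpoint gbin (t : C) (n k : nat) : C :=
  match n, k with
  | _, O => 1%C
  | O, S _ => 0%C
  | S n', S k' => (gbin t n' (S k') + cexp (INR (n' - k') * t) * gbin t n' k')%C
  end.

Lemma gbin_gt (t : C) (n k : nat) : (n < k)%nat -> gbin t n k = 0%C.
Proof.
  revert k; induction n as [|n IH]; intros [|k] H; try lia; [easy|].
  simpl. rewrite !IH by lia. ring.
Qed.

Lemma gbin_0_r (t : C) (n : nat) : gbin t n 0 = 1%C.
Proof. now destruct n. Qed.

Lemma gbin_fact (t : C) (n k : nat) : (k <= n)%nat ->
  (gbin t n k * cprod (etaf t) k * cprod (etaf t) (n - k))%C = cprod (etaf t) n.
Proof.
  revert k; induction n as [|n IH]; intros k Hk.
  - replace k with O by lia. simpl. ring.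
  - destruct k as [|k]; [simpl; ring|].
    change (gbin t (S n) (S k))
      with (gbin t n (S k) + cexp (INR (n - k) * t) * gbin t n k)%C.
    replace (S n - S k)%nat with (n - k)%nat by lia.
    assert (HS : forall m, cprod (etaf t) (S m) = (cprod (etaf t) m * (1 - cexp (INR (S m) * t)))%C)
      by reflexivity.
    assert (Hsplit : (cexp (INR (n - k) * t) * cexp (INR (S k) * t))%C = cexp (INR (S n) * t)).
    { rewrite <- cexp_plus. f_equal. rewrite <- Cmult_plus_distr_r, <- RtoC_plus, <- plus_INR.
      do 3 f_equal. lia. }
    destruct (Nat.eq_dec k n) as [->|Hne].
    + rewrite gbin_gt by lia. rewrite !HS. pose proof (IH n (Nat.le_refl n)) as H1.
      rewrite Nat.sub_diag in *. rewrite <- H1 at 2. simpl INR. rewrite Cmult_0_l, cexp_0. ring.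
    + pose proof (IH (S k) ltac:(lia)) as H1. pose proof (IH k ltac:(lia)) as H2.
      replace (n - k)%nat with (S (n - S k)) in * by lia.
      rewrite (HS n), <- Hsplit. rewrite !HS in *.
      set (a := cexp (INR (S (n - S k)) * t)) in *. set (b := cexp (INR (S k) * t)) in *.
      (* The q-Pascal rule reduces to 1 - ab = (1 - a) + a (1 - b). *)
      transitivity ((1 - a) * cprod (etaf t) n + a * (1 - b) * cprod (etaf t) n)%C; [|ring].
      rewrite <- H1 at 1. rewrite <- H2. ring.
Qed.

(** The term (-1)^k p^(k(k-1)/2) x^k of the Jacobi series; hiding the sign in [ipi] keeps it a
    single exponential, so products of terms become sums of exponents. *)
Definition gauss_term (t y : C) (k : Z) : C :=
  cexp (IZR (k * (k - 1)) / 2 * t + IZR k * (y + ipi)).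

Lemma gauss_term_succ (t y : C) (k : Z) :
  gauss_term t y (k + 1) = (- cexp (y + IZR k * t) * gauss_term t y k)%C.
Proof.
  unfold gauss_term.
  replace (IZR ((k + 1) * (k + 1 - 1)) / 2 * t + IZR (k + 1) * (y + ipi))%C
    with (ipi + ((y + IZR k * t) + (IZR (k * (k - 1)) / 2 * t + IZR k * (y + ipi))))%C.
  - rewrite (cexp_plus ipi), cexp_ipi, cexp_plus. ring.
  - rewrite !mult_IZR, !minus_IZR, !plus_IZR, !RtoC_mult, !RtoC_minus, !RtoC_plus. field.
Qed.

Lemma q_binomial (t y : C) (n : nat) :
  cprod (fun k => 1 - cexp (y + INR k * t))%C n =
  csum (fun k => gbin t n k * gauss_term t y (Z.of_nat k))%C (seq 0 (S n)).
Proof.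
  induction n as [|n IH].
  - simpl. unfold gauss_term. rewrite !Cmult_0_l. unfold Cdiv. rewrite !Cmult_0_l, Cplus_0_l, cexp_0.
    ring.
  - cbn [cprod]. rewrite IH.
    rewrite <- (cons_seq (S n)), csum_cons, <- seq_shift, csum_map.
    transitivity (
      (gbin t (S n) 0 * gauss_term t y (Z.of_nat 0)) +
      (csum (fun k => gbin t n (S k) * gauss_term t y (Z.of_nat (S k)))%C (seq 0 (S n)) +
       csum (fun k => (- cexp (y + INR n * t)) * (gbin t n k * gauss_term t y (Z.of_nat k)))%C
         (seq 0 (S n))))%C.
    + rewrite csum_scal.
      (* The top index can be added freely because its coefficient vanishes; this aligns the two
         sums that the q-Pascal rule produces. *)
      assert (HL : csum (fun k => gbin t n k * gauss_term t y (Z.of_nat k))%C (seq 0 (S (S n))) =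
              csum (fun k => gbin t n k * gauss_term t y (Z.of_nat k))%C (seq 0 (S n))).
      { rewrite (seq_S (S n)), csum_app, csum_cons. simpl (csum _ nil). rewrite gbin_gt by lia. ring. }
      rewrite <- (cons_seq (S n)), csum_cons, <- seq_shift, csum_map in HL. rewrite !gbin_0_r in *.
      set (S0 := csum _ (seq 0 (S n))) in *. set (S1 := csum _ (seq 0 (S n))) in *.
      rewrite Cplus_assoc, HL. ring.
    + f_equal. rewrite <- csum_plus. apply csum_ext. intros k Hk. apply in_seq in Hk.
      change (gbin t (S n) (S k))
        with (gbin t n (S k) + cexp (INR (n - k) * t) * gbin t n k)%C.
      replace (Z.of_nat (S k)) with (Z.of_nat k + 1)%Z by lia. rewrite gauss_term_succ.
      replace (y + INR n * t)%C with ((y + IZR (Z.of_nat k) * t) + INR (n - k) * t)%C.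
      * rewrite (cexp_plus (y + IZR (Z.of_nat k) * t)). ring.
      * rewrite <- INR_IZR_INZ, minus_INR, RtoC_minus by lia. ring.
Qed.

(** The [n] factors with exponents z - jt, for j from 1 to n, are inverted by 1 - y = -y (1 - 1/y);
    the prefactor collects the terms -y. *)
Lemma finite_theta_shift (t z : C) (n : nat) :
  cprod (fun k => 1 - cexp (z - INR n * t + INR k * t))%C (2 * n) =
  (cexp (INR n * (z + ipi) - INR n * (INR n + 1) / 2 * t) * cprod (thetaf t z) n)%C.
Proof.
  induction n as [|n IH].
  - simpl. replace (_ - _)%C with (RtoC 0) by (simpl; field). rewrite cexp_0. ring.
  - replace (2 * S n)%nat with (S (S (2 * n))) by lia.
    rewrite cprod_S_l. cbn [cprod].
    rewrite (cprod_ext _ (fun k => 1 - cexp (z - INR n * t + INR k * t))%C).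
    + rewrite IH.
      change (thetaf t z n)
        with ((1 - cexp (z + INR n * t)) * (1 - cexp (INR (S n) * t - z)))%C.
      replace (INR (S n) * (z + ipi) - INR (S n) * (INR (S n) + 1) / 2 * t)%C
        with ((ipi + (z - INR (S n) * t)) +
              (INR n * (z + ipi) - INR n * (INR n + 1) / 2 * t))%C
        by (rewrite S_INR, RtoC_plus; field).
      replace (z - INR (S n) * t + INR (S (2 * n)) * t)%C with (z + INR n * t)%C
        by (rewrite !S_INR, mult_INR, !RtoC_plus, RtoC_mult; simpl INR; rewrite RtoC_plus; ring).
      replace (z - INR (S n) * t + INR 0 * t)%C with (z - INR (S n) * t)%C by (simpl INR; ring).
      replace (INR (S n) * t - z)%C with (- (z - INR (S n) * t))%C by ring.
      rewrite !cexp_plus, cexp_opp, cexp_ipi. field. apply cexp_nonzero.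
    + intros k. do 2 f_equal. rewrite !S_INR, !RtoC_plus. ring.
Qed.

(** The q-binomial theorem for 2n factors starting at x p^(-n), with the summation index recentred
    at [n]. *)
Lemma finite_triple_product (t z : C) (n : nat) :
  cprod (thetaf t z) n =
  csum (fun j => gbin t (2 * n) (Z.to_nat (Z.of_nat n + j)) * gauss_term t z j)%C (zrange n).
Proof.
  set (W := cexp (INR n * (z + ipi) - INR n * (INR n + 1) / 2 * t)).
  assert (HW : W <> 0%C) by apply cexp_nonzero.
  assert (H : (W * cprod (thetaf t z) n)%C = (W * csum (fun j =>
     gbin t (2 * n) (Z.to_nat (Z.of_nat n + j)) * gauss_term t z j)%C (zrange n))%C).
  { unfold W. rewrite <- finite_theta_shift, q_binomial.
    unfold zrange. rewrite csum_map, <- csum_scal.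
    replace (2 * n + 1)%nat with (S (2 * n)) by lia.
    apply csum_ext. intros k _.
    replace (Z.to_nat (Z.of_nat n + (Z.of_nat k - Z.of_nat n))) with k by lia.
    unfold gauss_term.
    set (x := gbin t (2 * n) k).
    transitivity (x * (cexp (INR n * (z + ipi) - INR n * (INR n + 1) / 2 * t) *
      cexp (IZR ((Z.of_nat k - Z.of_nat n) * (Z.of_nat k - Z.of_nat n - 1)) / 2 * t +
            IZR (Z.of_nat k - Z.of_nat n) * (z + ipi))))%C; [|ring].
    f_equal. rewrite <- cexp_plus. f_equal.
    rewrite !mult_IZR, !minus_IZR, <- !INR_IZR_INZ, !RtoC_mult, !RtoC_minus. field. }
  transitivity (/ W * (W * cprod (thetaf t z) n))%C; [field; exact HW|].
  rewrite H. field. exact HW.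
Qed.

Lemma gbin_quot (t : C) (n k : nat) : Re t < 0 -> (k <= n)%nat ->
  gbin t n k =
  (cprod (etaf t) n * (/ cprod (etaf t) k * / cprod (etaf t) (n - k)))%C.
Proof.
  intros Ht Hk. rewrite <- (gbin_fact t n k Hk). field.
  split; apply cprod_nonzero; intros j; now apply etaf_nonzero.
Qed.

Lemma gbin_bounded (t : C) : Re t < 0 ->
  exists B, 0 < B /\ forall n k, Cmod (gbin t n k) <= B.
Proof.
  intros Ht.
  destruct (Clim_bounded _ _ (euler_lim t Ht)) as [M1 [H1 HM1]].
  destruct (Clim_bounded _ _ (Clim_inv _ _ (euler_nonzero t Ht) (euler_lim t Ht)))
    as [M2 [H2 HM2]].
  exists (M1 * (M2 * M2)). split; [apply Rmult_lt_0_compat; nra|].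
  intros n k. destruct (Nat.le_gt_cases k n) as [Hk|Hk].
  - rewrite gbin_quot by assumption. rewrite !Cmod_mult.
    repeat apply Rmult_le_compat; auto using Cmod_ge_0.
    apply Rmult_le_pos; apply Cmod_ge_0.
  - rewrite gbin_gt, Cmod_0 by exact Hk. apply Rmult_le_pos; nra.
Qed.

Lemma gbin_central_lim (t : C) (j : Z) : Re t < 0 ->
  Clim (fun n => gbin t (2 * n) (Z.to_nat (Z.of_nat n + j))) (/ euler t)%C.
Proof.
  intros Ht. pose proof (euler_nonzero t Ht) as HE.
  (* Positive and negative parts of [j]: they express n + j and n - j by natural subtraction as soon
     as n >= a + b. *)
  set (a := Z.to_nat j). set (b := Z.to_nat (- j)).
  apply Clim_ext_loc with (fun n => cprod (etaf t) (2 * n) *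
    (/ cprod (etaf t) (n - b + a) * / cprod (etaf t) (n - a + b)))%C.
  - exists (a + b)%nat. intros n Hn. rewrite gbin_quot by (auto; lia).
    do 4 f_equal; lia.
  - replace (/ euler t)%C with (euler t * (/ euler t * / euler t))%C by (field; exact HE).
    assert (Hsub : forall c d : nat, Clim (fun n => cprod (etaf t) (n - c + d)%nat) (euler t)).
    { intros c d.
      apply (is_lim_seq_subseq (fun n => Cmod (cprod (etaf t) n - euler t)) 0
               (fun n => (n - c + d)%nat)); [|apply euler_lim, Ht].
      intros P [N HN]. exists (N + c)%nat. intros n Hn. apply HN. lia. }
    apply Clim_mult; [|apply Clim_mult; apply Clim_inv; auto].
    apply (Clim_subseq (cprod (etaf t)) _ (fun n => 2 * n)%nat); [intros; lia|now apply euler_lim].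
Qed.

(** * Gaussian decay and the limit of the triple product *)

Lemma exp_le_zweight (k : Z) : exp (- Rabs (IZR k)) <= zweight k.
Proof.
  unfold zweight. rewrite <- abs_IZR, <- Zabs2Nat.id_abs, <- INR_IZR_INZ.
  induction (Z.abs_nat k) as [|n IH]; [simpl; rewrite Ropp_0, exp_0; lra|].
  rewrite S_INR. replace (- (INR n + 1)) with (- (1) + - INR n) by ring.
  rewrite exp_plus. simpl pow.
  apply Rmult_le_compat; try (left; apply exp_pos); [|exact IH].
  rewrite exp_Ropp. apply Rinv_le_contravar; [lra|].
  pose proof (exp_ineq1_le 1). lra.
Qed.

Lemma gaussian_bound (x y w : C) : Re x < 0 ->
  exists M, 0 <= M /\
    forall k : Z, Cmod (cexp (IZR (k * k) * x + IZR k * y + w)) <= M * zweight k.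
Proof.
  (* The extra 1 in [c] pays for the factor exp(-|k|); completing the square in -s X^2 + c X then
     leaves the constant c^2 / (4s). *)
  intros Hx. set (s := - Re x). set (c := Rabs (Re y) + 1).
  exists (exp (Re w + c * c / (4 * s))). split; [left; apply exp_pos|]. intros k.
  eapply Rle_trans; [|apply Rmult_le_compat_l; [left; apply exp_pos|apply exp_le_zweight]].
  rewrite Cmod_cexp, <- exp_plus.
  assert (Hle : Re (IZR (k * k) * x + IZR k * y + w)%C <=
                Re w + c * c / (4 * s) + - Rabs (IZR k)).
  { replace (Re (IZR (k * k) * x + IZR k * y + w)%C)
      with (- s * (IZR k * IZR k) + IZR k * Re y + Re w)
      by (unfold s; rewrite mult_IZR; destruct x, y, w; simpl; ring).
    assert (Hsq : IZR k * IZR k = Rabs (IZR k) * Rabs (IZR k)).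
    { rewrite <- Rabs_mult, Rabs_pos_eq; [easy|apply Rle_0_sqr]. }
    assert (Hy : IZR k * Re y <= Rabs (IZR k) * Rabs (Re y)).
    { rewrite <- Rabs_mult. apply Rle_abs. }
    rewrite Hsq. set (X := Rabs (IZR k)) in *.
    assert (Hs : 0 < s) by (unfold s; lra).
    assert (Hq : 0 <= s * ((X - c / (2 * s)) * (X - c / (2 * s)))) by (apply Rmult_le_pos; [lra|apply Rle_0_sqr]).
    replace (s * ((X - c / (2 * s)) * (X - c / (2 * s))))
      with (s * (X * X) - c * X + c * c / (4 * s)) in Hq by (field; lra).
    unfold c in *. nra. }
  destruct Hle as [Hlt|Heq]; [left; now apply exp_increasing|right; now rewrite Heq].
Qed.

Lemma gauss_term_bound (t z : C) : Re t < 0 ->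
  exists M, 0 <= M /\ forall k : Z, Cmod (gauss_term t z k) <= M * zweight k.
Proof.
  intros Ht. destruct (gaussian_bound (t / 2) (z + ipi - t / 2) 0) as [M [HM H]].
  { unfold Cdiv. rewrite <- RtoC_inv, re_scal_r by lra. lra. }
  exists M; split; [exact HM|]. intros k. eapply Rle_trans; [right|apply H].
  unfold gauss_term. do 2 f_equal.
  rewrite !mult_IZR, minus_IZR, !RtoC_mult, RtoC_minus. field.
Qed.

(** Jacobi's triple product. In its finite form the coefficients are bounded uniformly and tend to
    [/ euler t], so Tannery's theorem applies. *)
Lemma theta_series (t z : C) : Re t < 0 ->
  Clim (fun n => csum (gauss_term t z) (zrange n)) (euler t * theta t z)%C.
Proof.
  intros Ht. pose proof (euler_nonzero t Ht) as HE.
  destruct (gauss_term_bound t z Ht) as [M [HM Hb]].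
  pose proof (summable_scal zrange zweight M HM summable_zweight) as Hsum.
  destruct (summable_cv _ _ _ Hsum Hb) as [J HJ].
  destruct (gbin_bounded t Ht) as [B [HB HBb]].
  assert (HT : Clim (fun n => csum (fun j =>
     (gbin t (2 * n) (Z.to_nat (Z.of_nat n + j)) - / euler t) * gauss_term t z j)%C
     (zrange n)) 0%C).
  { apply (tannery _ _ _ _ (B + Cmod (/ euler t)) Hsum Hb).
    - pose proof (Cmod_ge_0 (/ euler t)). lra.
    - intros n j. eapply Rle_trans; [apply Cmod_triangle|]. rewrite Cmod_opp.
      apply Rplus_le_compat_r, HBb.
    - intros j. replace (RtoC 0) with (/ euler t - / euler t)%C by ring.
      apply Clim_minus; [now apply gbin_central_lim|apply Clim_const]. }
  assert (H0 : RtoC 0 = (theta t z - / euler t * J)%C).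
  { eapply Clim_unique; [exact HT|].
    apply Clim_ext with (fun n => cprod (thetaf t z) n -
      / euler t * csum (gauss_term t z) (zrange n))%C.
    - intros n. rewrite finite_triple_product.
      rewrite <- csum_scal.
      transitivity (csum (fun j =>
        gbin t (2 * n) (Z.to_nat (Z.of_nat n + j)) * gauss_term t z j)%C (zrange n) +
        (-(1)) * csum (fun j => / euler t * gauss_term t z j)%C (zrange n))%C; [ring|].
      rewrite <- csum_scal, <- csum_plus. apply csum_ext; intros; ring.
    - apply Clim_minus; [now apply theta_lim|now apply Clim_scal]. }
  replace (euler t * theta t z)%C with J; [exact HJ|].
  replace (theta t z) with (0 + / euler t * J)%C by (rewrite H0; ring). field. exact HE.
Qed.

(** Terms of the theta series with period doubled, in even and odd powers of x: up to normalisation,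
    Jacobi's theta_3 and theta_2. They are the two functions in the determinant. *)
Definition even_term (t z : C) (k : Z) : C := cexp (IZR (k * k) * t + IZR k * (2 * z)).
Definition odd_term (t z : C) (k : Z) : C :=
  cexp (IZR (k * k + k) * t + (IZR (2 * k) + 1) * z).

Definition theta_even (t z : C) : C := Cval (fun n => csum (even_term t z) (zrange n)).
Definition theta_odd (t z : C) : C := Cval (fun n => csum (odd_term t z) (zrange n)).

Lemma even_term_bound (t z : C) : Re t < 0 ->
  exists M, 0 <= M /\ forall k : Z, Cmod (even_term t z k) <= M * zweight k.
Proof.
  intros Ht. destruct (gaussian_bound t (2 * z) 0 Ht) as [M [HM H]].
  exists M; split; [exact HM|]. intros k. eapply Rle_trans; [right|apply H].
  unfold even_term. do 2 f_equal. ring.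
Qed.

Lemma odd_term_bound (t z : C) : Re t < 0 ->
  exists M, 0 <= M /\ forall k : Z, Cmod (odd_term t z k) <= M * zweight k.
Proof.
  intros Ht. destruct (gaussian_bound t (t + 2 * z) z Ht) as [M [HM H]].
  exists M; split; [exact HM|]. intros k. eapply Rle_trans; [right|apply H].
  unfold odd_term. do 2 f_equal.
  rewrite plus_IZR, (mult_IZR 2), RtoC_plus, RtoC_mult. ring.
Qed.

Lemma theta_even_lim (t z : C) : Re t < 0 ->
  Clim (fun n => csum (even_term t z) (zrange n)) (theta_even t z).
Proof.
  intros Ht. destruct (even_term_bound t z Ht) as [M [HM Hb]].
  destruct (summable_cv _ _ _ (summable_scal _ _ M HM summable_zweight) Hb) as [l Hl].
  unfold theta_even. now rewrite (Clim_Cval _ _ Hl).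
Qed.

Lemma theta_odd_lim (t z : C) : Re t < 0 ->
  Clim (fun n => csum (odd_term t z) (zrange n)) (theta_odd t z).
Proof.
  intros Ht. destruct (odd_term_bound t z Ht) as [M [HM Hb]].
  destruct (summable_cv _ _ _ (summable_scal _ _ M HM summable_zweight) Hb) as [l Hl].
  unfold theta_odd. now rewrite (Clim_Cval _ _ Hl).
Qed.

Lemma theta_odd_shift_lim (t z : C) : Re t < 0 ->
  Clim (fun n => csum (fun k => odd_term t z (k - 1)) (zrange n)) (theta_odd t z).
Proof.
  intros Ht. destruct (odd_term_bound t z Ht) as [M [HM Hb]].
  (* Enlarging the radius by one makes the shifted window contain [zrange n], so the rearrangement
     can use the identity for [phi]. *)
  apply is_lim_seq_incr_1.
  apply (Clim_ext (fun n => csum (odd_term t z) (map (fun k => k - 1)%Z (zrange (S n))))).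
  { intros n. apply csum_map. }
  apply (Clim_rearrange zrange _ _ _ _ (fun n => n)
          (summable_scal _ _ M HM summable_zweight) Hb); [| | | |now apply theta_odd_lim].
  - intros n. apply NoDup_map_NoDup_ForallPairs; [intros a b _ _ H; lia|apply NoDup_zrange].
  - intros n k. rewrite in_zrange, in_map_iff. intros H. exists (k + 1)%Z.
    rewrite in_zrange. lia.
  - intros n. exists (S (S n)). intros k. rewrite in_map_iff.
    intros [j [<- Hj]]. rewrite in_zrange in *. lia.
  - intros P HP. exact HP.
Qed.

(** Index pairs with even sum: in the coordinates m, n the quadratic form has no cross term, so [a]
    and [b] separate. The shift m - 1 comes from the linear part of the exponent. *)
Lemma gauss_term_even (t a b : C) (m n : Z) :
  (gauss_term t (a + b) (m + n) * gauss_term t (a - b) (m - n))%C =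
  (cexp a * odd_term t a (m - 1) * even_term t b n)%C.
Proof.
  unfold gauss_term, odd_term, even_term.
  transitivity (cexp (IZR (2 * m) * ipi) *
    (cexp a * cexp (IZR ((m - 1) * (m - 1) + (m - 1)) * t + (IZR (2 * (m - 1)) + 1) * a) *
     cexp (IZR (n * n) * t + IZR n * (2 * b))))%C; [|rewrite cexp_2ipi; ring].
  rewrite <- !cexp_plus. f_equal.
  repeat rewrite ?mult_IZR, ?plus_IZR, ?minus_IZR, ?RtoC_mult, ?RtoC_minus, ?RtoC_plus. field.
Qed.

Lemma gauss_term_odd (t a b : C) (m n : Z) :
  (gauss_term t (a + b) (m + n + 1) * gauss_term t (a - b) (m - n))%C =
  (- (cexp a * even_term t a m * odd_term t b n))%C.
Proof.
  unfold gauss_term, odd_term, even_term.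
  transitivity (cexp ipi * (cexp (IZR (2 * m) * ipi) *
    (cexp a * cexp (IZR (m * m) * t + IZR m * (2 * a)) *
     cexp (IZR (n * n + n) * t + (IZR (2 * n) + 1) * b))))%C;
    [|rewrite cexp_2ipi, cexp_ipi; ring].
  rewrite <- !cexp_plus. f_equal.
  repeat rewrite ?mult_IZR, ?plus_IZR, ?minus_IZR, ?RtoC_mult, ?RtoC_minus, ?RtoC_plus. field.
Qed.

(** * Regrouping the double series by parity *)

Lemma csum_opp {A : Type} (f : A -> C) (l : list A) :
  csum (fun a => - f a)%C l = (- csum f l)%C.
Proof. induction l as [|a l IH]; simpl; [ring|rewrite IH; ring]. Qed.

(** The two images are the pairs of even and of odd sum. Over this region the double sum factors
    exactly, in contrast with a square in the original indices. *)
Definition diamond (n : nat) : list (Z * Z) :=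
  map (fun mn => (fst mn + snd mn, fst mn - snd mn)%Z) (zsquare n) ++
  map (fun mn => (fst mn + snd mn + 1, fst mn - snd mn)%Z) (zsquare n).

Lemma NoDup_diamond (n : nat) : NoDup (diamond n).
Proof.
  apply NoDup_app.
  - apply NoDup_map_NoDup_ForallPairs; [|apply NoDup_zsquare].
    intros [a b] [c d] _ _ H. injection H as H1 H2. simpl in *. f_equal; lia.
  - apply NoDup_map_NoDup_ForallPairs; [|apply NoDup_zsquare].
    intros [a b] [c d] _ _ H. injection H as H1 H2. simpl in *. f_equal; lia.
  - intros [j k] H1 H2. apply in_map_iff in H1, H2.
    destruct H1 as [[a b] [H1 _]], H2 as [[c d] [H2 _]].
    injection H1 as H1 H1'. injection H2 as H2 H2'. simpl in *. lia.
Qed.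

Lemma incl_zsquare_diamond (n : nat) : incl (zsquare (n / 2)) (diamond n).
Proof.
  intros [j k]. rewrite in_zsquare. intros [Hj Hk].
  assert (H2 : (2 * Z.of_nat (n / 2) <= Z.of_nat n)%Z).
  { pose proof (Nat.Div0.mul_div_le n 2). lia. }
  apply in_or_app.
  pose proof (Z.div_mod (j + k) 2 ltac:(lia)) as Hd.
  pose proof (Z.mod_pos_bound (j + k) 2 ltac:(lia)) as Hm.
  (* Inverse of the parity change of coordinates: m is the floor of (j + k) / 2 and the second
     coordinate is m - k. *)
  set (m := ((j + k) / 2)%Z) in *.
  destruct (Z.eq_dec ((j + k) mod 2) 0) as [H0|H0]; [left|right]; apply in_map_iff;
    exists (m, m - k)%Z; (split; [simpl; f_equal; lia|apply in_zsquare; lia]).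
Qed.

Lemma incl_diamond_zsquare (n : nat) : incl (diamond n) (zsquare (2 * n + 1)).
Proof.
  intros [j k] H. apply in_app_or in H. destruct H as [H|H]; apply in_map_iff in H;
    destruct H as [[a b] [H Hab]]; injection H as <- <-; rewrite in_zsquare in *; simpl; lia.
Qed.

(** The product of the two Jacobi series is summed over diamonds: pairs of even sum give the first
    term of the determinant, pairs of odd sum the second, the sign being (-1)^(2m+1). *)
Lemma theta_bilinear (t a b : C) : Re t < 0 ->
  (euler t * theta t (a + b) * (euler t * theta t (a - b)))%C =
  (cexp a * (theta_odd t a * theta_even t b - theta_even t a * theta_odd t b))%C.
Proof.
  intros Ht.
  destruct (gauss_term_bound t (a + b) Ht) as [M1 [HM1 H1]].
  destruct (gauss_term_bound t (a - b) Ht) as [M2 [HM2 H2]].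
  set (T := fun jk : Z * Z =>
    (gauss_term t (a + b) (fst jk) * gauss_term t (a - b) (snd jk))%C).
  apply (Clim_unique (fun n => csum T (diamond n))).
  - apply (Clim_rearrange zsquare diamond
      (fun jk => M1 * M2 * (zweight (fst jk) * zweight (snd jk))) T _ (fun n => n / 2)%nat).
    + apply summable_scal; [nra|apply summable_zsquare].
    + intros [j k]. unfold T; simpl. rewrite Cmod_mult.
      replace (M1 * M2 * (zweight j * zweight k)) with (M1 * zweight j * (M2 * zweight k)) by ring.
      apply Rmult_le_compat; auto using Cmod_ge_0.
    + apply NoDup_diamond.
    + apply incl_zsquare_diamond.
    + intros n. exists (2 * n + 1)%nat. apply incl_diamond_zsquare.
    + intros P [N HN]. exists (2 * N)%nat. intros n Hn. apply HN.
      apply Nat.div_le_lower_bound; lia.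
    + apply (Clim_ext (fun n => csum (gauss_term t (a + b)) (zrange n) *
                                csum (gauss_term t (a - b)) (zrange n))%C).
      * intros n. symmetry. apply csum_prod.
      * apply Clim_mult; now apply theta_series.
  - apply (Clim_ext (fun n =>
      cexp a * (csum (fun k => odd_term t a (k - 1)) (zrange n) * csum (even_term t b) (zrange n)
      - csum (even_term t a) (zrange n) * csum (odd_term t b) (zrange n)))%C).
    + intros n. unfold diamond. rewrite csum_app, !csum_map.
      rewrite (csum_ext (fun mn => T (fst mn + snd mn, fst mn - snd mn)%Z)
        (fun mn => cexp a * (odd_term t a (fst mn - 1) * even_term t b (snd mn)))%C (zsquare n)).
      * rewrite (csum_ext (fun mn => T (fst mn + snd mn + 1, fst mn - snd mn)%Z)
          (fun mn => - (cexp a * (even_term t a (fst mn) * odd_term t b (snd mn))))%C (zsquare n)).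
        -- unfold zsquare. rewrite csum_opp, !csum_scal.
           rewrite (csum_prod (even_term t a)), (csum_prod (fun k => odd_term t a (k - 1))). ring.
        -- intros [m k] _. unfold T; simpl. rewrite gauss_term_odd. ring.
      * intros [m k] _. unfold T; simpl. rewrite gauss_term_even. ring.
    + apply Clim_scal, Clim_minus; apply Clim_mult;
        auto using theta_even_lim, theta_odd_lim, theta_odd_shift_lim.
Qed.

(** * Three-term relation and half periods *)

Lemma cexp_INR_lim (t z : C) : Re t < 0 -> Clim (fun n => cexp (z + INR n * t)) 0%C.
Proof.
  intros Ht. apply Clim_squeeze with (fun n => exp (Re z) * exp (Re t) ^ n).
  - intros n. replace (cexp (z + INR n * t) - 0)%C with (cexp (z + INR n * t)) by ring.
    rewrite Cmod_cexp_INR. apply Rle_refl.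
  - replace 0 with (exp (Re z) * 0) by ring.
    apply is_lim_seq_mult'; [apply is_lim_seq_const|]. apply is_lim_seq_geom.
    rewrite Rabs_pos_eq by (left; apply exp_pos). rewrite <- exp_0. now apply exp_increasing.
Qed.

Lemma theta_ext (t z z' : C) : Re t < 0 ->
  (forall k, thetaf t z k = thetaf t z' k) -> theta t z = theta t z'.
Proof.
  intros Ht H. apply (Clim_unique (cprod (thetaf t z))); [now apply theta_lim|].
  apply (Clim_ext (cprod (thetaf t z'))); [|now apply theta_lim].
  intros n. symmetry. now apply cprod_ext.
Qed.

Lemma theta_reflect (t z : C) : Re t < 0 -> theta t (t - z) = theta t z.
Proof.
  intros Ht. apply theta_ext; [exact Ht|]. intros k. unfold thetaf.
  rewrite S_INR, RtoC_plus.
  replace (t - z + INR k * t)%C with ((INR k + 1) * t - z)%C by ring.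
  replace ((INR k + 1) * t - (t - z))%C with (z + INR k * t)%C by ring. ring.
Qed.

Lemma theta_period (t z : C) : Re t < 0 -> theta t (z + 2 * ipi) = theta t z.
Proof.
  intros Ht. apply theta_ext; [exact Ht|]. intros k. unfold thetaf.
  pose proof (cexp_2ipi 1) as H1. simpl (2 * 1)%Z in H1.
  replace (z + 2 * ipi + INR k * t)%C with (2 * ipi + (z + INR k * t))%C by ring.
  replace (INR (S k) * t - (z + 2 * ipi))%C with (- (2 * ipi) + (INR (S k) * t - z))%C by ring.
  rewrite (cexp_plus (2 * ipi)), (cexp_plus (- _)), cexp_opp, H1. f_equal; f_equal; field.
Qed.

(** Changing the sign of [z] exchanges the two families of factors up to an offset of one index; for
    partial products this leaves one boundary factor on each side, tending to 1. *)
Lemma theta_opp (t z : C) : Re t < 0 -> theta t (- z) = (- (cexp (- z) * theta t z))%C.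
Proof.
  intros Ht.
  assert (Hn : forall n, (cprod (thetaf t (- z)) n * (1 - cexp (- z + INR n * t)))%C =
    (- cexp (- z) * (cprod (thetaf t z) n * (1 - cexp (z + INR n * t))))%C).
  { induction n as [|n IH].
    - simpl. rewrite Cmult_0_l, !Cplus_0_r, cexp_opp. field. apply cexp_nonzero.
    - cbn [cprod]. unfold thetaf at 2 4.
      replace (INR (S n) * t - - z)%C with (z + INR (S n) * t)%C by ring.
      replace (INR (S n) * t - z)%C with (- z + INR (S n) * t)%C by ring.
      set (x := cexp (- z + INR (S n) * t)). set (y := cexp (z + INR (S n) * t)).
      transitivity ((cprod (thetaf t (- z)) n * (1 - cexp (- z + INR n * t))) *
        ((1 - y) * (1 - x)))%C; [ring|]. rewrite IH. ring. }
  assert (Hl : forall w, Clim (fun n => cprod (thetaf t w) n * (1 - cexp (w + INR n * t)))%C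
                           (theta t w)).
  { intros w. replace (theta t w) with (theta t w * (1 - 0))%C by ring.
    apply Clim_mult; [now apply theta_lim|].
    apply Clim_minus; [apply Clim_const|now apply cexp_INR_lim]. }
  apply (Clim_unique _ _ _ (Hl (- z)%C)).
  eapply Clim_ext; [intros n; symmetry; apply Hn|].
  replace (- (cexp (- z) * theta t z))%C with (- cexp (- z) * theta t z)%C by ring.
  apply Clim_scal, Hl.
Qed.

(** Each factor splits by 1 - y^2 = (1 - y)(1 + y). Even indices yield the points [z] and [z + ipi],
    odd indices those shifted by [t / 2]; hence 2n factors on the left against n in each product. *)
Lemma theta_duplication (t z : C) : Re t < 0 ->
  theta t (2 * z) =
  (theta t z * theta t (z + ipi) * (theta t (z + t / 2) * theta t (z + t / 2 + ipi)))%C.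
Proof.
  intros Ht.
  apply (Clim_unique (fun n => cprod (thetaf t (2 * z)) (2 * n))).
  - apply (Clim_subseq _ _ (fun n => 2 * n)%nat); [intros; lia|now apply theta_lim].
  - apply (Clim_ext (fun n => cprod (thetaf t z) n * cprod (thetaf t (z + ipi)) n *
      (cprod (thetaf t (z + t / 2)) n * cprod (thetaf t (z + t / 2 + ipi)) n))%C);
      [|repeat apply Clim_mult; now apply theta_lim].
    induction n as [|n IH]; [simpl; ring|].
    replace (2 * S n)%nat with (S (S (2 * n))) by lia. cbn [cprod]. rewrite <- IH.
    set (P1 := cprod _ _). set (P2 := cprod _ _). set (P3 := cprod _ _). set (P4 := cprod _ _).
    transitivity (P1 * P2 * (P3 * P4) *
      ((thetaf t z n * thetaf t (z + ipi) n) *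
       (thetaf t (z + t / 2) n * thetaf t (z + t / 2 + ipi) n)))%C; [ring|].
    rewrite <- (Cmult_assoc (P1 * P2 * (P3 * P4))). f_equal. unfold thetaf.
    rewrite !S_INR, !mult_INR. repeat rewrite ?RtoC_plus, ?RtoC_mult. simpl INR.
    rewrite RtoC_plus.
    set (k := RtoC (INR n)).
    set (x := cexp (z + k * t)). set (y := cexp ((k + 1) * t - z)).
    set (x' := cexp (z + t / 2 + k * t)). set (y' := cexp ((k + 1) * t - (z + t / 2))).
    replace (cexp (2 * z + (1 + 1) * k * t)) with (x * x)%C
      by (unfold x; rewrite <- cexp_plus; f_equal; ring).
    replace (cexp (((1 + 1) * k + 1) * t - 2 * z)) with (y' * y')%C
      by (unfold y'; rewrite <- cexp_plus; f_equal; field).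
    replace (cexp (2 * z + ((1 + 1) * k + 1) * t)) with (x' * x')%C
      by (unfold x'; rewrite <- cexp_plus; f_equal; field).
    replace (cexp (((1 + 1) * k + 1 + 1) * t - 2 * z)) with (y * y)%C
      by (unfold y; rewrite <- cexp_plus; f_equal; field).
    replace (z + ipi + k * t)%C with (ipi + (z + k * t))%C by ring.
    replace ((k + 1) * t - (z + ipi))%C with (- ipi + ((k + 1) * t - z))%C by ring.
    replace (z + t / 2 + ipi + k * t)%C with (ipi + (z + t / 2 + k * t))%C by ring.
    replace ((k + 1) * t - (z + t / 2 + ipi))%C
      with (- ipi + ((k + 1) * t - (z + t / 2)))%C by ring.
    rewrite !(cexp_plus ipi), !(cexp_plus (- ipi)), cexp_opp, cexp_ipi.
    fold x y x' y'. field.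
Qed.

(** Euler's identity squared: (1 + p^k)(1 - p^k) = 1 - p^(2k) completes the odd-exponent factors to
    the full Euler product. The 2 is the unpaired factor 1 + p^0. *)
Lemma theta_half_periods (t : C) : Re t < 0 ->
  (theta t ipi * (theta t (t / 2) * theta t (t / 2 + ipi)))%C = 2%C.
Proof.
  intros Ht. pose proof (euler_nonzero t Ht) as HE.
  assert (Hn : forall n, (cprod (thetaf t ipi) n *
     (cprod (thetaf t (t / 2)) n * cprod (thetaf t (t / 2 + ipi)) n) *
     (cprod (etaf t) n * cprod (etaf t) n) * (1 + cexp (0 + INR n * t)))%C =
     (2 * (cprod (etaf t) (2 * n) * cprod (etaf t) (2 * n)))%C).
  { induction n as [|n IH].
    - simpl. rewrite Cmult_0_l, Cplus_0_l, cexp_0. ring.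
    - replace (2 * S n)%nat with (S (S (2 * n))) by lia. cbn [cprod].
      set (Q := cprod (etaf t) (2 * n)) in *.
      transitivity (2 * (Q * Q) *
        (etaf t (2 * n) * etaf t (2 * n) * (etaf t (S (2 * n)) * etaf t (S (2 * n)))))%C;
        [|ring].
      rewrite <- IH.
      set (P1 := cprod _ _). set (P2 := cprod _ _). set (P3 := cprod _ _). set (P4 := cprod _ _).
      rewrite !Cplus_0_l. unfold thetaf, etaf.
      rewrite !S_INR, !mult_INR. repeat rewrite ?RtoC_plus, ?RtoC_mult. simpl INR.
      rewrite RtoC_plus.
      set (k := RtoC (INR n)).
      set (x := cexp (k * t)). set (y := cexp ((k + 1) * t)).
      set (w := cexp (t / 2 + k * t)).
      replace (cexp (((1 + 1) * k + 1) * t)) with (w * w)%C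
        by (unfold w; rewrite <- cexp_plus; f_equal; field).
      replace (cexp (((1 + 1) * k + 1 + 1) * t)) with (y * y)%C
        by (unfold y; rewrite <- cexp_plus; f_equal; ring).
      replace ((k + 1) * t - ipi)%C with (- ipi + (k + 1) * t)%C by ring.
      replace ((k + 1) * t - (t / 2 + ipi))%C with (- ipi + (t / 2 + k * t))%C by field.
      replace ((k + 1) * t - t / 2)%C with (t / 2 + k * t)%C by field.
      replace (t / 2 + ipi + k * t)%C with (ipi + (t / 2 + k * t))%C by ring.
      rewrite !(cexp_plus ipi), !(cexp_plus (- ipi)), cexp_opp, cexp_ipi.
      fold x y w. field. }
  set (c := (theta t ipi * (theta t (t / 2) * theta t (t / 2 + ipi)))%C).
  assert (H : (c * (euler t * euler t) * (1 + 0))%C = (2 * (euler t * euler t))%C).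
  { eapply Clim_unique.
    - apply (Clim_mult _ _ _ _ (Clim_mult _ _ _ _ (Clim_mult _ _ _ _ (theta_lim t ipi Ht)
        (Clim_mult _ _ _ _ (theta_lim t (t / 2) Ht) (theta_lim t (t / 2 + ipi) Ht)))
        (Clim_mult _ _ _ _ (euler_lim t Ht) (euler_lim t Ht)))
        (Clim_plus _ _ _ _ (Clim_const 1) (cexp_INR_lim t 0 Ht))).
    - eapply Clim_ext; [intros n; symmetry; apply Hn|].
      apply Clim_scal.
      assert (H2 : Clim (fun n => cprod (etaf t) (2 * n)) (euler t))
        by (apply (Clim_subseq _ _ (fun n => 2 * n)%nat); [intros; lia|now apply euler_lim]).
      now apply Clim_mult. }
  transitivity (c * (euler t * euler t) * (1 + 0) / (euler t * euler t))%C; [field; exact HE|].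
  rewrite H. field. exact HE.
Qed.

(** Stands for sigma(a+b) sigma(a-b): dividing by [cexp a] removes the prefactor in [theta_bilinear]
    and leaves an antisymmetric determinant. *)
Definition sigma2 (t a b : C) : C := (theta t (a + b) * theta t (a - b) / cexp a)%C.

(* Weierstrass's three-term relation: [sigma2] is a 2x2 determinant, so this is a Pluecker relation. *)
Lemma sigma2_three_term (t a b c d : C) : Re t < 0 ->
  (sigma2 t a b * sigma2 t c d - sigma2 t a c * sigma2 t b d + sigma2 t a d * sigma2 t b c)%C = 0%C.
Proof.
  intros Ht. pose proof (euler_nonzero t Ht) as HE.
  assert (H : forall x y, sigma2 t x y =
    ((theta_odd t x * theta_even t y - theta_even t x * theta_odd t y) /
     (euler t * euler t))%C).
  { intros x y. unfold sigma2. pose proof (theta_bilinear t x y Ht) as Hb.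
    transitivity (euler t * theta t (x + y) * (euler t * theta t (x - y)) /
      (euler t * euler t * cexp x))%C; [field; split; auto using cexp_nonzero|].
    rewrite Hb. field; split; auto using cexp_nonzero. }
  rewrite !H. field. exact HE.
Qed.

(* Up to a constant factor this is [wp b - wp a]. *)
Definition wpdiff (t a b : C) : C := (sigma2 t a b / (sigma2 t a 0 * sigma2 t b 0))%C.

Lemma sigma2_0 (t a : C) : sigma2 t a 0 = (theta t a * theta t a / cexp a)%C.
Proof.
  unfold sigma2. replace (a + 0)%C with a by ring. now replace (a - 0)%C with a by ring.
Qed.

Lemma sigma2_0_nonzero (t a : C) : theta t a <> 0%C -> sigma2 t a 0 <> 0%C.
Proof.
  intros H. rewrite sigma2_0. apply Cdiv_neq_0; auto using Cmult_neq_0, cexp_nonzero.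
Qed.

(** The three-term relation with fourth point 0, divided by the product of the three [sigma2] values
    at 0. It lets all differences be measured from one base point. *)
Lemma wpdiff_chain (t a b c : C) : Re t < 0 ->
  theta t a <> 0%C -> theta t b <> 0%C -> theta t c <> 0%C ->
  wpdiff t a c = (wpdiff t a b + wpdiff t b c)%C.
Proof.
  intros Ht Ha Hb Hc. unfold wpdiff.
  pose proof (sigma2_three_term t a b c 0 Ht) as H.
  apply sigma2_0_nonzero in Ha, Hb, Hc.
  set (ab := sigma2 t a b) in *. set (ac := sigma2 t a c) in *. set (bc := sigma2 t b c) in *.
  set (a0 := sigma2 t a 0) in *. set (b0 := sigma2 t b 0) in *. set (c0 := sigma2 t c 0) in *.
  transitivity ((ac * b0) / (a0 * b0 * c0))%C; [field; auto|].
  replace (ac * b0)%C with (ab * c0 + a0 * bc)%C; [field; auto|].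
  apply Ceq_minus. rewrite <- H. ring.
Qed.

(** * Half periods *)

Lemma theta_sub_ipi (t a : C) : Re t < 0 -> theta t (a - ipi) = theta t (a + ipi).
Proof.
  intros Ht. rewrite <- (theta_period t (a - ipi) Ht). f_equal. ring.
Qed.

(** The two arguments differ by the quasi-period [t], hence the multiplier; it is obtained from
    [theta_opp] followed by reflection. *)
Lemma theta_sub_half (t a : C) : Re t < 0 ->
  theta t (a - t / 2) = (- (cexp a / cexp (t / 2) * theta t (a + t / 2)))%C.
Proof.
  intros Ht.
  replace (a - t / 2)%C with (- (t / 2 - a))%C by ring.
  rewrite theta_opp by exact Ht.
  rewrite <- (theta_reflect t (t / 2 - a) Ht).
  replace (t - (t / 2 - a))%C with (a + t / 2)%C by field.
  replace (- (t / 2 - a))%C with (a - t / 2)%C by ring. now rewrite cexp_minus.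
Qed.

Lemma sigma2_ipi (t a : C) : Re t < 0 ->
  sigma2 t a ipi = (theta t (a + ipi) * theta t (a + ipi) / cexp a)%C.
Proof. intros Ht. unfold sigma2. now rewrite theta_sub_ipi. Qed.

Lemma sigma2_half (t a : C) : Re t < 0 ->
  sigma2 t a (t / 2) = (- (theta t (a + t / 2) * theta t (a + t / 2) / cexp (t / 2)))%C.
Proof.
  intros Ht. unfold sigma2. rewrite theta_sub_half by exact Ht.
  field. split; apply cexp_nonzero.
Qed.

Lemma sigma2_half_ipi (t a : C) : Re t < 0 ->
  sigma2 t a (t / 2 + ipi) =
  (theta t (a + t / 2 + ipi) * theta t (a + t / 2 + ipi) / cexp (t / 2))%C.
Proof.
  intros Ht. unfold sigma2.
  replace (a - (t / 2 + ipi))%C with ((a - t / 2) - ipi)%C by ring.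
  rewrite theta_sub_ipi by exact Ht.
  replace (a - t / 2 + ipi)%C with ((a + ipi) - t / 2)%C by ring.
  rewrite theta_sub_half, cexp_plus, cexp_ipi by exact Ht.
  replace (a + (t / 2 + ipi))%C with (a + t / 2 + ipi)%C by ring.
  replace (a + ipi + t / 2)%C with (a + t / 2 + ipi)%C by ring.
  field. split; apply cexp_nonzero.
Qed.

(** The point [ipi] lies on the boundary of the strip of [theta_nonzero]; a product equal to 2
    settles all three values at once. *)
Lemma theta_half_periods_nonzero (t : C) : Re t < 0 ->
  theta t ipi <> 0%C /\ theta t (t / 2) <> 0%C /\ theta t (t / 2 + ipi) <> 0%C.
Proof.
  intros Ht. pose proof (theta_half_periods t Ht) as H.
  assert (H2 : RtoC 2 <> 0%C) by (intros E; apply RtoC_inj in E; lra).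
  repeat split; intros H0; apply H2; rewrite <- H, H0; ring.
Qed.

(* The analogue of [wp'(a)^2 = 4 prod_i (wp a - e_i) = sigma(2a)^2 / sigma(a)^8]. *)
Lemma wpdiff_half_periods_prod (t a : C) : Re t < 0 -> theta t a <> 0%C ->
  (wpdiff t a ipi * wpdiff t a (t / 2) * wpdiff t a (t / 2 + ipi))%C =
  (- (cexp a ^ 2 * theta t (2 * a) ^ 2 / (4 * theta t a ^ 8)))%C.
Proof.
  intros Ht Ha.
  destruct (theta_half_periods_nonzero t Ht) as (H1 & H2 & H3).
  pose proof (theta_half_periods t Ht) as Hc.
  unfold wpdiff. rewrite theta_duplication by exact Ht.
  rewrite !sigma2_0, sigma2_ipi, sigma2_half, sigma2_half_ipi by exact Ht.
  rewrite (cexp_plus (t / 2) ipi), cexp_ipi.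
  pose proof (cexp_nonzero a). pose proof (cexp_nonzero (t / 2)).
  set (c1 := theta t ipi) in *. set (c2 := theta t (t / 2)) in *.
  set (c3 := theta t (t / 2 + ipi)) in *.
  set (x0 := theta t a) in *. set (x1 := theta t (a + ipi)).
  set (x2 := theta t (a + t / 2)). set (x3 := theta t (a + t / 2 + ipi)).
  set (e := cexp a) in *. set (h := cexp (t / 2)) in *.
  transitivity (- (e ^ 2 * (x0 * x1 * (x2 * x3)) ^ 2 / ((c1 * (c2 * c3)) ^ 2 * x0 ^ 8)))%C.
  - field. repeat split; assumption.
  - rewrite Hc. field. repeat split; assumption.
Qed.

(** The modular discriminant in this normalisation. The sum of two half periods is the third up to
    periods, so numerators and denominators involve the same three theta values, and these combine
    into the fourth power of their product 2. *)
Lemma wpdiff_half_periods_disc (t : C) : Re t < 0 ->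
  ((wpdiff t ipi (t / 2) * wpdiff t ipi (t / 2 + ipi) * wpdiff t (t / 2) (t / 2 + ipi)) ^ 2)%C
  = (cexp t / 16)%C.
Proof.
  intros Ht.
  destruct (theta_half_periods_nonzero t Ht) as (H1 & H2 & H3).
  pose proof (theta_half_periods t Ht) as Hc.
  unfold wpdiff. rewrite !sigma2_0, sigma2_half, !sigma2_half_ipi by exact Ht.
  rewrite !(cexp_plus (t / 2) ipi), cexp_ipi.
  replace (ipi + t / 2 + ipi)%C with (t / 2 + 2 * ipi)%C by ring.
  rewrite theta_period by exact Ht.
  replace (t / 2 + t / 2 + ipi)%C with (t - - ipi)%C by field.
  rewrite theta_reflect by exact Ht.
  replace (- ipi)%C with (0 - ipi)%C by ring. rewrite theta_sub_ipi by exact Ht.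
  replace (0 + ipi)%C with ipi by ring.
  replace (ipi + t / 2)%C with (t / 2 + ipi)%C by ring.
  replace (cexp t) with (cexp (t / 2) * cexp (t / 2))%C
    by (rewrite <- cexp_plus; f_equal; field).
  pose proof (cexp_nonzero (t / 2)).
  set (c1 := theta t ipi) in *. set (c2 := theta t (t / 2)) in *.
  set (c3 := theta t (t / 2 + ipi)) in *. set (h := cexp (t / 2)) in *.
  transitivity (h * h / (c1 * (c2 * c3)) ^ 4)%C.
  - field. repeat split; assumption.
  - rewrite Hc. field.
Qed.

(** * The 7-torsion point *)

(* A monic cubic is determined by its values at three points; here the points
   are [0, -A, -A(1+Z)] and the values those of the Tate normal form with a 7-torsion point. *)
Lemma cubic_disc_7_torsion (A Z a b c : C) :
  A <> 0%C -> Z <> 0%C -> (1 + Z)%C <> 0%C ->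
  (a * b * c = - (A ^ 3 * (1 + Z) ^ 3 / (4 * Z)))%C ->
  ((a + A) * (b + A) * (c + A) = - (A ^ 3 * Z / (4 * (1 + Z))))%C ->
  ((a + A * (1 + Z)) * (b + A * (1 + Z)) * (c + A * (1 + Z)) =
    - (A ^ 3 * Z ^ 3 * (1 + Z) / 4))%C ->
  (((b - a) * (c - a) * (c - b)) ^ 2 =
    A ^ 6 * (1 - 5 * Z - 8 * Z ^ 2 - Z ^ 3) * (Z * (1 + Z)) / 16)%C.
Proof.
  intros HA HZ HZ1 E1 E2 E3.
  set (s1 := (a + b + c)%C). set (s2 := (a * b + a * c + b * c)%C). set (s3 := (a * b * c)%C).
  (* Divided differences with the leading term removed: both are linear in [s1] and [s2], and g2 -
     g1 = A Z s1, so they recover the coefficients of the cubic. *)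
  set (g1 := ((((a + A) * (b + A) * (c + A)) - a * b * c) / A - A ^ 2)%C).
  set (g2 := (((a + A * (1 + Z)) * (b + A * (1 + Z)) * (c + A * (1 + Z)) - a * b * c) /
               (A * (1 + Z)) - (A * (1 + Z)) ^ 2)%C).
  assert (Hg1 : g1 = (s2 + A * s1)%C) by (unfold g1, s1, s2; field; exact HA).
  assert (Hg2 : g2 = (s2 + A * (1 + Z) * s1)%C) by (unfold g2, s1, s2; field; auto).
  assert (Hs1 : s1 = ((g2 - g1) / (A * Z))%C) by (rewrite Hg1, Hg2; field; auto).
  assert (Hs2 : s2 = (g1 - A * s1)%C) by (rewrite Hg1; ring).
  (* The discriminant of a monic cubic in the elementary symmetric functions of its roots. *)
  transitivity (s1 ^ 2 * s2 ^ 2 - 4 * s2 ^ 3 - 4 * s1 ^ 3 * s3 + 18 * s1 * s2 * s3 - 27 * s3 ^ 2)%C.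
  { unfold s1, s2, s3. ring. }
  rewrite Hs2, Hs1. unfold s3, g1, g2. rewrite E1, E2, E3. field. auto.
Qed.

Lemma Re_period (T : C) : Re T < 0 -> Re (7 * T) < 0.
Proof. rewrite re_scal_l. lra. Qed.

Lemma theta_torsion_nonzero (T : C) : Re T < 0 ->
  theta (7 * T) T <> 0%C /\ theta (7 * T) (2 * T) <> 0%C /\ theta (7 * T) (3 * T) <> 0%C.
Proof.
  intros HT. repeat split; (apply theta_nonzero; [now apply Re_period|]);
    rewrite ?re_scal_l; lra.
Qed.

Lemma theta_torsion_sym (T : C) (k : R) : Re T < 0 ->
  theta (7 * T) ((7 - k)%R * T) = theta (7 * T) (k * T).
Proof.
  intros HT. rewrite <- theta_reflect by now apply Re_period. f_equal.
  rewrite RtoC_minus. ring.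
Qed.

Lemma theta_torsion_4 (T : C) : Re T < 0 -> theta (7 * T) (4 * T) = theta (7 * T) (3 * T).
Proof.
  intros HT. rewrite <- (theta_torsion_sym T 3 HT). do 3 f_equal. lra.
Qed.

Lemma theta_torsion_5 (T : C) : Re T < 0 -> theta (7 * T) (5 * T) = theta (7 * T) (2 * T).
Proof.
  intros HT. rewrite <- (theta_torsion_sym T 2 HT). do 3 f_equal. lra.
Qed.

Lemma theta_torsion_6 (T : C) : Re T < 0 -> theta (7 * T) (6 * T) = theta (7 * T) T.
Proof.
  intros HT. rewrite <- (Cmult_1_l T) at 4. rewrite <- (theta_torsion_sym T 1 HT).
  do 3 f_equal. lra.
Qed.

Lemma cexp_2 (T : C) : cexp (2 * T) = (cexp T ^ 2)%C.
Proof. replace (2 * T)%C with (T + T)%C by ring. rewrite cexp_plus. ring. Qed.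

Lemma cexp_3 (T : C) : cexp (3 * T) = (cexp T ^ 3)%C.
Proof.
  replace (3 * T)%C with (2 * T + T)%C by ring. rewrite cexp_plus, cexp_2. ring.
Qed.

(** With quasi-period [7 * T], sums and differences of the indices 1, 2, 3 return to 1, 2, 3 up to
    reflection, so this difference and the next two are monomials in the same three theta values and
    q. *)
Lemma wpdiff_21 (T : C) : Re T < 0 ->
  wpdiff (7 * T) (2 * T) T = (cexp T * theta (7 * T) (3 * T) / (theta (7 * T) T * theta (7 * T) (2 * T) ^ 2))%C.
Proof.
  intros HT. destruct (theta_torsion_nonzero T HT) as (H1 & H2 & H3).
  pose proof (cexp_nonzero T) as Hq.
  unfold wpdiff. rewrite !sigma2_0. unfold sigma2.
  replace (2 * T + T)%C with (3 * T)%C by ring. replace (2 * T - T)%C with T by ring.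
  rewrite cexp_2. field. auto.
Qed.

Lemma wpdiff_31 (T : C) : Re T < 0 ->
  wpdiff (7 * T) (3 * T) T = (cexp T * theta (7 * T) (2 * T) / (theta (7 * T) T ^ 2 * theta (7 * T) (3 * T)))%C.
Proof.
  intros HT. destruct (theta_torsion_nonzero T HT) as (H1 & H2 & H3).
  pose proof (cexp_nonzero T) as Hq.
  unfold wpdiff. rewrite !sigma2_0. unfold sigma2.
  replace (3 * T + T)%C with (4 * T)%C by ring. replace (3 * T - T)%C with (2 * T)%C by ring.
  rewrite cexp_3, theta_torsion_4 by exact HT. field. auto.
Qed.

Lemma wpdiff_32 (T : C) : Re T < 0 ->
  wpdiff (7 * T) (3 * T) (2 * T) = (cexp T ^ 2 * theta (7 * T) T / (theta (7 * T) (2 * T) * theta (7 * T) (3 * T) ^ 2))%C.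
Proof.
  intros HT. destruct (theta_torsion_nonzero T HT) as (H1 & H2 & H3).
  pose proof (cexp_nonzero T) as Hq.
  unfold wpdiff. rewrite !sigma2_0. unfold sigma2.
  replace (3 * T + 2 * T)%C with (5 * T)%C by ring. replace (3 * T - 2 * T)%C with T by ring.
  rewrite cexp_3, cexp_2, theta_torsion_5 by exact HT. field. auto.
Qed.

(** The chain relation from 3T through 2T to T, multiplied by (th1 th2 th3)^2 / q. *)
Lemma klein_quartic (T : C) : Re T < 0 ->
  let q := cexp T in let th1 := theta (7 * T) T in
  let th2 := theta (7 * T) (2 * T) in let th3 := theta (7 * T) (3 * T) in
  (th2 ^ 3 * th3 = q * th1 ^ 3 * th2 + th1 * th3 ^ 3)%C.
Proof.
  intros HT q th1 th2 th3.
  destruct (theta_torsion_nonzero T HT) as (H1 & H2 & H3).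
  fold th1 th2 th3 in H1, H2, H3. pose proof (cexp_nonzero T : q <> 0%C) as Hq.
  pose proof (wpdiff_chain (7 * T) (3 * T) (2 * T) T (Re_period T HT) H3 H2 H1) as H.
  rewrite wpdiff_21, wpdiff_31, wpdiff_32 in H by exact HT. fold q th1 th2 th3 in H.
  transitivity ((q * th2 / (th1 ^ 2 * th3)) * (th1 ^ 2 * th2 ^ 2 * th3 ^ 2 / q))%C;
    [field; auto|]. rewrite H. field. auto.
Qed.

Lemma theta_torsion_relation (T : C) : Re T < 0 ->
  let q := cexp T in let th1 := theta (7 * T) T in
  let th2 := theta (7 * T) (2 * T) in let th3 := theta (7 * T) (3 * T) in
  let Z := (q * th1 ^ 2 * th2 / th3 ^ 3)%C in
  (1 + Z = th2 ^ 3 / (th1 * th3 ^ 2) /\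
   (th1 * th2 * th3) ^ 4 / q = (1 - 5 * Z - 8 * Z ^ 2 - Z ^ 3) / (Z * (1 + Z)))%C.
Proof.
  intros HT q th1 th2 th3 Z. set (t := (7 * T)%C) in *.
  destruct (theta_torsion_nonzero T HT) as (H1 & H2 & H3).
  fold t in H1, H2, H3. fold th1 th2 th3 in H1, H2, H3.
  pose proof (cexp_nonzero T : q <> 0%C) as Hq.
  pose proof (Re_period T HT : Re t < 0) as Hp.
  assert (HZ1 : (1 + Z)%C = (th2 ^ 3 / (th1 * th3 ^ 2))%C).
  { transitivity ((q * th1 ^ 3 * th2 + th1 * th3 ^ 3) / (th1 * th3 ^ 3))%C;
      [unfold Z; field; auto|]. rewrite <- (klein_quartic T HT : th2 ^ 3 * th3 = q * th1 ^ 3 * th2 + th1 * th3 ^ 3)%C. field. auto. }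
  split; [exact HZ1|].
  assert (HZn : Z <> 0%C).
  { apply Cdiv_neq_0; auto using Cmult_neq_0, Cpow_nz. }
  assert (HZ1n : (1 + Z)%C <> 0%C).
  { rewrite HZ1. apply Cdiv_neq_0; auto using Cmult_neq_0, Cpow_nz. }
  (* This is the [wpdiff] from 2T to T, and A (1 + Z) will be the one from 3T to T. With the origin
     placed at T, the three torsion points have coordinates 0, -A, -A (1 + Z) and the roots are
     [e1], [e2], [e3]. *)
  set (A := (q * th3 / (th1 * th2 ^ 2))%C).
  assert (HA : A <> 0%C).
  { apply Cdiv_neq_0; auto using Cmult_neq_0, Cpow_nz. }
  destruct (theta_half_periods_nonzero t Hp) as (Hw1 & Hw2 & Hw3).
  set (e1 := wpdiff t T ipi). set (e2 := wpdiff t T (t / 2)).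
  set (e3 := wpdiff t T (t / 2 + ipi)).
  pose proof (wpdiff_half_periods_prod t T Hp H1) as F1.
  pose proof (wpdiff_half_periods_prod t (2 * T) Hp H2) as F2.
  pose proof (wpdiff_half_periods_prod t (3 * T) Hp H3) as F3.
  pose proof (wpdiff_half_periods_disc t Hp) as FD.
  rewrite (wpdiff_chain t (2 * T) T ipi), (wpdiff_chain t (2 * T) T (t / 2)),
    (wpdiff_chain t (2 * T) T (t / 2 + ipi)), (wpdiff_21 T HT : wpdiff t _ _ = _) in F2 by assumption.
  rewrite (wpdiff_chain t (3 * T) T ipi), (wpdiff_chain t (3 * T) T (t / 2)),
    (wpdiff_chain t (3 * T) T (t / 2 + ipi)), (wpdiff_31 T HT : wpdiff t _ _ = _) in F3 by assumption.
  assert (Hd : forall a b : C, theta t a <> 0%C -> theta t b <> 0%C ->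
    wpdiff t a b = (wpdiff t T b - wpdiff t T a)%C).
  { intros a b Ha Hb. rewrite (wpdiff_chain t T a b) by assumption. ring. }
  rewrite (Hd ipi), (Hd ipi), (Hd (t / 2)%C) in FD by assumption.
  fold e1 e2 e3 in F1, F2, F3, FD.
  (* Doubling permutes the torsion points up to sign, since 4 = -3 and 6 = -1 mod 7; the values of
     the cubic therefore stay monomials in [th1], [th2], [th3] and [q]. *)
  replace (2 * (2 * T))%C with (4 * T)%C in F2 by ring.
  replace (2 * (3 * T))%C with (6 * T)%C in F3 by ring.
  rewrite (theta_torsion_4 T HT : theta t _ = _), cexp_2 in F2. rewrite (theta_torsion_6 T HT : theta t _ = _), cexp_3 in F3.
  change (theta (7 * T)) with (theta t) in *.
  fold q th1 th2 th3 in F1, F2, F3. fold A in F2.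
  replace (q * th2 / (th1 ^ 2 * th3))%C with (A * (1 + Z))%C in F3
    by (rewrite HZ1; unfold A; field; auto).
  assert (Hdisc : (((e2 - e1) * (e3 - e1) * (e3 - e2)) ^ 2 =
    A ^ 6 * (1 - 5 * Z - 8 * Z ^ 2 - Z ^ 3) * (Z * (1 + Z)) / 16)%C).
  { apply cubic_disc_7_torsion; try assumption.
    - rewrite F1, HZ1. unfold A, Z. field. auto.
    - replace ((e1 + A) * (e2 + A) * (e3 + A))%C with ((A + e1) * (A + e2) * (A + e3))%C by ring.
      rewrite F2, HZ1. unfold A, Z. field. auto.
    - set (B := (A * (1 + Z))%C) in *.
      replace ((e1 + B) * (e2 + B) * (e3 + B))%C with ((B + e1) * (B + e2) * (B + e3))%C by ring.
      rewrite F3, HZ1. unfold A, Z. field. auto. }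
  rewrite FD in Hdisc.
  replace (cexp t) with (q ^ 7)%C in Hdisc.
  2:{ unfold t. replace (7 * T)%C with (3 * T + 3 * T + T)%C by ring.
      rewrite !cexp_plus, cexp_3. fold q. ring. }
  set (N := (1 - 5 * Z - 8 * Z ^ 2 - Z ^ 3)%C) in *.
  (* The discriminant identity solved for the cubic in [Z]; after division by Z (1 + Z), the
     monomials for [A], [Z] and 1 + Z collapse to (th1 th2 th3)^4 / q. *)
  assert (HN : N = (q ^ 7 / 16 * (16 / (A ^ 6 * (Z * (1 + Z)))))%C)
    by (rewrite Hdisc; field; auto).
  rewrite HN, HZ1. unfold A, Z. field. auto.
Qed.

(** * From powers of q to theta values, and the eta quotient *)

Lemma cexp_pow (z : C) (n : nat) : cexp (INR n * z) = (cexp z ^ n)%C.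
Proof.
  induction n as [|n IH].
  - simpl INR. rewrite Cmult_0_l, cexp_0. reflexivity.
  - rewrite S_INR, RtoC_plus.
    replace ((INR n + 1) * z)%C with (z + INR n * z)%C by ring.
    rewrite cexp_plus, IH, Cpow_S. reflexivity.
Qed.

(** A logarithm of q: it is the [T] of the torsion lemmas, and 7T is the matching logarithm of p. *)
Definition nome_log (tau : C) : C := ((2 * PI)%R * (Ci * tau))%C.

Lemma Re_nome_log (tau : C) : 0 < Im tau -> Re (nome_log tau) < 0.
Proof.
  intros H. unfold nome_log. rewrite re_scal_l.
  replace (Re (Ci * tau)%C) with (- Im tau) by (destruct tau; simpl; ring).
  pose proof PI_RGT_0. nra.
Qed.

Lemma qpow_cexp (tau : C) (a : R) : qpow tau a = cexp (a * nome_log tau).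
Proof. unfold qpow, nome_log. f_equal. rewrite (RtoC_mult (2 * PI)). ring. Qed.

Lemma qpow_frac (tau : C) (n : nat) (d : R) : d <> 0 ->
  qpow tau (INR n / d) = (cexp (nome_log tau / d) ^ n)%C.
Proof.
  intros Hd. rewrite qpow_cexp, <- cexp_pow. f_equal.
  rewrite RtoC_div by exact Hd. field. intros E. apply Hd. now apply RtoC_inj in E.
Qed.

Lemma nome_log_7 (tau : C) : nome_log (7 * tau) = (7 * nome_log tau)%C.
Proof. unfold nome_log. ring. Qed.

Lemma eta_fac_etaf (tau : C) (k : nat) : eta_fac tau k = etaf (nome_log tau) k.
Proof. unfold eta_fac, etaf, omq. now rewrite qpow_cexp. Qed.

(** As b = 7 - a, the second exponent is 7 (k + 1) - a, which is the reflected factor of the theta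
    product. *)
Lemma omq_theta (tau : C) (a b : nat) (k : nat) : (a + b = 7)%nat ->
  (omq tau (7 * k + a) * omq tau (7 * k + b))%C =
  thetaf (7 * nome_log tau) (INR a * nome_log tau) k.
Proof.
  intros Hab. unfold omq, thetaf. rewrite !qpow_cexp. set (T := nome_log tau).
  replace b with (7 - a)%nat by lia.
  apply f_equal2; apply (f_equal (fun x => 1 - cexp x)%C);
    rewrite ?S_INR, ?plus_INR, ?mult_INR, ?minus_INR by lia;
    repeat rewrite ?RtoC_plus, ?RtoC_mult, ?RtoC_minus; simpl INR;
    repeat rewrite ?RtoC_plus; ring.
Qed.

Lemma omq_eta (tau : C) (k : nat) : omq tau (7 * k + 7) = etaf (7 * nome_log tau) k.
Proof.
  unfold omq, etaf. rewrite qpow_cexp. set (T := nome_log tau).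
  do 2 f_equal. rewrite S_INR, plus_INR, mult_INR.
  repeat rewrite ?RtoC_plus, ?RtoC_mult; simpl INR; repeat rewrite ?RtoC_plus. ring.
Qed.

Lemma triple_fac_prod (tau P : C) (f : nat -> C) (a : nat) : 0 < Im tau ->
  (forall k, f k = thetaf (7 * nome_log tau) (INR a * nome_log tau) k *
                   etaf (7 * nome_log tau) k)%C ->
  is_inf_prod f P ->
  P = (theta (7 * nome_log tau) (INR a * nome_log tau) * euler (7 * nome_log tau))%C.
Proof.
  intros Htau Hf HP.
  pose proof (Re_period _ (Re_nome_log tau Htau)) as Ht.
  apply (Clim_unique (cprod f)); [now apply is_inf_prod_Clim|].
  apply (Clim_ext (fun n => cprod (thetaf (7 * nome_log tau) (INR a * nome_log tau)) n *
                            cprod (etaf (7 * nome_log tau)) n)%C).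
  - intros n. rewrite <- cprod_mult. apply cprod_ext. intros k. now rewrite Hf.
  - apply Clim_mult; [now apply theta_lim|now apply euler_lim].
Qed.

(** Residues mod 7: the u, v, w factors cover each nonzero class once but the class of 0 three
    times, hence two extra Euler products on the eta side. *)
Lemma eta_fac_dissection (tau : C) (n : nat) :
  (cprod (eta_fac tau) (7 * n) *
    (cprod (etaf (7 * nome_log tau)) n * cprod (etaf (7 * nome_log tau)) n))%C =
  (cprod (u_fac tau) n * cprod (v_fac tau) n * cprod (w_fac tau) n)%C.
Proof.
  induction n as [|n IH]; [simpl; ring|].
  replace (7 * S n)%nat with (S (S (S (S (S (S (S (7 * n))))))))%nat by lia.
  cbn [cprod].
  assert (He : forall k, eta_fac tau k = omq tau (S k)) by reflexivity.
  rewrite !He, <- !omq_eta.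
  change (u_fac tau n)
    with (omq tau (7 * n + 3) * omq tau (7 * n + 4) * omq tau (7 * n + 7))%C.
  change (v_fac tau n)
    with (omq tau (7 * n + 2) * omq tau (7 * n + 5) * omq tau (7 * n + 7))%C.
  change (w_fac tau n)
    with (omq tau (7 * n + 1) * omq tau (7 * n + 6) * omq tau (7 * n + 7))%C.
  transitivity (cprod (u_fac tau) n * cprod (v_fac tau) n * cprod (w_fac tau) n *
    (omq tau (7 * n + 1) * omq tau (7 * n + 2) * omq tau (7 * n + 3) * omq tau (7 * n + 4) *
     omq tau (7 * n + 5) * omq tau (7 * n + 6) *
     (omq tau (7 * n + 7) * omq tau (7 * n + 7) * omq tau (7 * n + 7))))%C; [|ring].
  rewrite <- IH.
  replace (7 * n + 1)%nat with (S (7 * n)) by lia.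
  replace (7 * n + 2)%nat with (S (S (7 * n))) by lia.
  replace (7 * n + 3)%nat with (S (S (S (7 * n)))) by lia.
  replace (7 * n + 4)%nat with (S (S (S (S (7 * n))))) by lia.
  replace (7 * n + 5)%nat with (S (S (S (S (S (7 * n)))))) by lia.
  replace (7 * n + 6)%nat with (S (S (S (S (S (S (7 * n))))))) by lia.
  replace (7 * n + 7)%nat with (S (S (S (S (S (S (S (7 * n)))))))) by lia.
  ring.
Qed.

(* Pu, Pv, Pw, E1, E7 are the values of the infinite products; then
   u = q^{1/56} Pu, v = q^{9/56} Pv, w = q^{25/56} Pw,
   eta(tau) = q^{1/24} E1, eta(7 tau) = e^{2 pi i (7 tau)/24} E7. *)
Theorem theorem6 :
  forall (tau : C), 0 < Im tau ->
  forall Pu Pv Pw E1 E7 : C,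
  is_inf_prod (u_fac tau) Pu ->
  is_inf_prod (v_fac tau) Pv ->
  is_inf_prod (w_fac tau) Pw ->
  is_inf_prod (eta_fac tau) E1 ->
  is_inf_prod (eta_fac (Cmult (RtoC 7) tau)) E7 ->
  let u := Cmult (qpow tau (1/56)) Pu in
  let v := Cmult (qpow tau (9/56)) Pv in
  let w := Cmult (qpow tau (25/56)) Pw in
  let eta1 := Cmult (qpow tau (1/24)) E1 in
  let eta7 := Cmult (qpow (Cmult (RtoC 7) tau) (1/24)) E7 in
  let r := Cpow (Cdiv eta1 eta7) 4 in
  Cminus (Cplus (Cdiv (Cmult (Cpow v 2) u) (Cpow w 3))
                (Cdiv (Cmult (Cpow u 2) w) (Cpow v 3)))
         (Cdiv (Cmult (Cpow w 2) v) (Cpow u 3))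
  = Cplus r (RtoC 8)
  /\
  Cminus (Cplus (Cdiv (Cpow w 3) (Cmult (Cpow v 2) u))
                (Cdiv (Cpow v 3) (Cmult (Cpow u 2) w)))
         (Cdiv (Cpow u 3) (Cmult (Cpow w 2) v))
  = Cminus (Copp r) (RtoC 5).
Proof.
  intros tau Htau Pu Pv Pw E1 E7 Hu Hv Hw HE1 HE7 u v w eta1 eta7 r.
  set (T := nome_log tau).
  pose proof (Re_nome_log tau Htau : Re T < 0) as HT.
  pose proof (Re_period T HT) as Ht.
  destruct (theta_torsion_nonzero T HT) as (H1 & H2 & H3).
  destruct (theta_torsion_relation T HT) as [HZ1 Hr].
  pose proof (euler_nonzero _ Ht) as HEn.
  assert (HPu : Pu = (theta (7 * T) (3 * T) * euler (7 * T))%C).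
  { replace 3 with (INR 3) by (simpl; ring). apply (triple_fac_prod tau Pu (u_fac tau) 3); auto.
    intros k. unfold u_fac. rewrite omq_eta, (omq_theta tau 3 4) by reflexivity. reflexivity. }
  assert (HPv : Pv = (theta (7 * T) (2 * T) * euler (7 * T))%C).
  { replace 2 with (INR 2) by (simpl; ring). apply (triple_fac_prod tau Pv (v_fac tau) 2); auto.
    intros k. unfold v_fac. rewrite omq_eta, (omq_theta tau 2 5) by reflexivity. reflexivity. }
  assert (HPw : Pw = (theta (7 * T) T * euler (7 * T))%C).
  { rewrite <- (Cmult_1_l T) at 2. replace 1 with (INR 1) by reflexivity.
    apply (triple_fac_prod tau Pw (w_fac tau) 1); auto.
    intros k. unfold w_fac. rewrite omq_eta, (omq_theta tau 1 6) by reflexivity. reflexivity. }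
  assert (HE7' : E7 = euler (7 * T)).
  { apply (Clim_unique (cprod (etaf (7 * T)))); [|now apply euler_lim].
    apply (Clim_ext (cprod (eta_fac (7 * tau)))); [|now apply is_inf_prod_Clim].
    intros n. apply cprod_ext. intros k. now rewrite eta_fac_etaf, nome_log_7. }
  assert (HE1' : E1 = (theta (7 * T) T * theta (7 * T) (2 * T) * theta (7 * T) (3 * T) *
                       euler (7 * T))%C).
  { assert (H : (E1 * (euler (7 * T) * euler (7 * T)))%C = (Pu * Pv * Pw)%C).
    { eapply Clim_unique; [|repeat apply Clim_mult; apply is_inf_prod_Clim; eassumption].
      eapply Clim_ext; [intros n; apply eta_fac_dissection|].
      apply Clim_mult; [|apply Clim_mult; now apply euler_lim].
      apply (Clim_subseq (cprod (eta_fac tau)) E1 (fun n => 7 * n)%nat); [intros; lia|].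
      now apply is_inf_prod_Clim. }
    transitivity (E1 * (euler (7 * T) * euler (7 * T)) / (euler (7 * T) * euler (7 * T)))%C;
      [field; exact HEn|]. rewrite H, HPu, HPv, HPw. field. exact HEn. }
  (* With q = s^56 = e^24, every fractional power becomes an integer power of a nonzero number,
     which [field] can handle. *)
  set (s := cexp (T / 56)). set (e := cexp (T / 24)).
  assert (Hs : s <> 0%C) by apply cexp_nonzero.
  assert (He : e <> 0%C) by apply cexp_nonzero.
  assert (Hq : cexp T = (s ^ 56)%C).
  { unfold s. rewrite <- cexp_pow. f_equal. rewrite INR_IZR_INZ. simpl. field. }
  assert (Hqe : cexp T = (e ^ 24)%C).
  { unfold e. rewrite <- cexp_pow. f_equal. rewrite INR_IZR_INZ. simpl. field. }
  assert (Hu' : u = (s * Pu)%C).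
  { unfold u. replace (1 / 56) with (INR 1 / 56) by (simpl; lra).
    rewrite qpow_frac by lra. fold T s. ring. }
  assert (Hv' : v = (s ^ 9 * Pv)%C).
  { unfold v. replace (9 / 56) with (INR 9 / 56) by (simpl; lra).
    rewrite qpow_frac by lra. reflexivity. }
  assert (Hw' : w = (s ^ 25 * Pw)%C).
  { unfold w. replace (25 / 56) with (INR 25 / 56) by (simpl; lra).
    rewrite qpow_frac by lra. reflexivity. }
  assert (He1 : eta1 = (e * E1)%C).
  { unfold eta1. replace (1 / 24) with (INR 1 / 24) by (simpl; lra).
    rewrite qpow_frac by lra. fold T e. ring. }
  assert (He7 : eta7 = (e ^ 7 * E7)%C).
  { unfold eta7. f_equal. rewrite qpow_cexp, nome_log_7. unfold e. rewrite <- cexp_pow. f_equal.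
    fold T. rewrite RtoC_div, INR_IZR_INZ by lra. simpl. field. }
  set (th1 := theta (7 * T) T) in *. set (th2 := theta (7 * T) (2 * T)) in *.
  set (th3 := theta (7 * T) (3 * T)) in *. set (E := euler (7 * T)) in *.
  set (Z := (cexp T * th1 ^ 2 * th2 / th3 ^ 3)%C) in *.
  assert (Hrr : r = ((th1 * th2 * th3) ^ 4 / cexp T)%C).
  { unfold r. rewrite He1, He7, HE1', HE7', Hqe. field. auto. }
  (* In this ratio and the next two, the exponents of [s] are 50 + 9 - 3 = 56, 18 + 1 - 75 = -56 and
     2 + 25 - 27 = 0, so only q, 1/q and 1 remain. *)
  assert (HZ : ((w ^ 2 * v) / u ^ 3)%C = Z).
  { unfold Z. rewrite Hu', Hv', Hw', HPu, HPv, HPw, Hq. field. auto. }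
  assert (HX : ((v ^ 2 * u) / w ^ 3)%C = ((1 + Z) / Z)%C).
  { rewrite HZ1. unfold Z. rewrite Hu', Hv', Hw', HPu, HPv, HPw, Hq. field. auto. }
  assert (HY : ((u ^ 2 * w) / v ^ 3)%C = (/ (1 + Z))%C).
  { rewrite HZ1. rewrite Hu', Hv', Hw', HPu, HPv, HPw. field. auto. }
  assert (Hun : u <> 0%C) by (rewrite Hu', HPu; auto using Cmult_neq_0).
  assert (Hvn : v <> 0%C) by (rewrite Hv', HPv; auto using Cmult_neq_0, Cpow_nz).
  assert (Hwn : w <> 0%C) by (rewrite Hw', HPw; auto using Cmult_neq_0, Cpow_nz).
  assert (HZn : Z <> 0%C).
  { rewrite <- HZ. apply Cdiv_neq_0; auto using Cmult_neq_0, Cpow_nz. }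
  assert (HZ1n : (1 + Z)%C <> 0%C).
  { rewrite HZ1. apply Cdiv_neq_0; auto using Cmult_neq_0, Cpow_nz. }
  assert (Hinv : forall a b : C, a <> 0%C -> b <> 0%C -> (b / a)%C = (/ (a / b))%C).
  { intros a b Ha Hb. field. auto. }
  (* Over the denominator Z (1 + Z) the left sides have numerators 1 + 3Z - Z^3 and Z^3 + 3Z^2 - 1.
     They differ from N = 1 - 5Z - 8Z^2 - Z^3 and from -N by 8Z (1 + Z) and -5Z (1 + Z), whence the
     constants 8 and -5. *)
  rewrite (Hinv (v ^ 2 * u)%C (w ^ 3)%C), (Hinv (u ^ 2 * w)%C (v ^ 3)%C),
    (Hinv (w ^ 2 * v)%C (u ^ 3)%C), HX, HY, HZ, Hrr, Hr
    by auto using Cmult_neq_0, Cpow_nz.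
  split; field; auto.
Qed.
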